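(* Let $F,G\in\mathcal O_m$, $m\ge3$, be reduced irreducible germs in general position at the origin. Let $\lambda\in\mathbb C\setminus\mathbb Q$ and assume that there exist constants $c>0$ and $\delta\ge0$ such that \[ |\lambda i+j|\ge\frac{c}{(|i|+|j|)^\delta},\qquad (i,j)\in\mathbb Z^2\setminus\{(0,0)\}. \] Put $\omega_0=\frac{dG}{G}-\lambda\frac{dF}{F}$. Given an analytic deformation of $\Omega_0=F\,dG-\lambda G\,dF$ by integrable $1$-forms \[ \Omega_t=\Omega_0+\sum_{k=1}^{+\infty}t^k\Omega_k, \] there are: a formal unit $\widehat U:=\prod_{k=1}^{+\infty}(1+t^ka_k)\in\mathcal M_m[[t]]$ with $a_k\in\mathcal M_m$; a formal function $\widehat H:=\sum_{k=1}^{+\infty}t^kh_k\in\mathcal M_m[[t]]$ with $h_k\in\mathcal M_m$; and formal power series $\widehat\alpha(t),\widehat\beta(t)\in\mathbb C[[t]]$ satisfying $\widehat\alpha(0)=-\lambda$, $\widehat\beta(0)=1$; such that \[ \Omega_t=\widehat U\left[\widehat\alpha(t)\,G\,dF+\widehat\beta(t)\,F\,dG+FG\,d\widehat H\right], \] where $d\widehat H:=\sum_{k=1}^{+\infty}t^k\,dh_k$.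
   Context: $\mathcal O_m$, $\mathcal M_m$: germs of holomorphic, resp. meromorphic, functions at $0\in\mathbb C^m$. $\mathcal M_m[[t]]$ is the ring of formal power series in $t$ over $\mathcal M_m$ (no uniform bound on pole orders of coefficients). Reduced germs $F,G\in\mathcal O_m$ vanishing at the origin are in general position at the origin if $dF(0)\wedge dG(0)\ne0$. An analytic deformation by integrable $1$-forms is a family $\Omega_t$ of germs of holomorphic $1$-forms at $0\in\mathbb C^m$, analytic in $t\in(\mathbb C,0)$, with $\Omega_t\wedge d\Omega_t=0$ for every $t$. The identity is between formal power series in $t$. *)

(* Defs.v *)
From HB Require Import structures.
From mathcomp Require Import all_boot all_order all_algebra.
From mathcomp Require Import boolp classical_sets reals topology normedtype.
From mathcomp Require Import sequences exp complex ring.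
From mathcomp.multinomials Require mpoly.
(* The notations of mpoly clash with those of mathcomp-analysis. *)
Import -(notations) mpoly.
Set Implicit Arguments.
Unset Strict Implicit.
Unset Printing Implicit Defensive.
Import Order.TTheory GRing.Theory Num.Theory numFieldNormedType.Exports.
Local Open Scope ring_scope.

(* The alias makes the topology of a numClosedFieldType available on R[i]. *)
Definition Cplx (R : realType) : numClosedFieldType := R[i]%C.

(* A germ at 0 in K^m of a holomorphic function is identified with its Taylor
   series at 0, so that the ring of germs is the ring K{x_1, .., x_m} of the
   power series that converge on some polydisc |x_i| < r (by Abel's lemma:
   such that the terms f_a r^|a| are bounded for some r > 0). *)
Definition converges (K : numFieldType) m (f : multinom m -> K) :=
  exists r M : K, 0 < r /\ forall a, `|f a| * r ^+ mdeg a <= M.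

Record holo (K : numFieldType) m := Holo {
  tcoef :> multinom m -> K;
  _ : converges tcoef }.

HB.instance Definition _ K m := gen_eqMixin (holo K m).
HB.instance Definition _ K m := gen_choiceMixin (holo K m).

Section Ring.
Variables (K : numFieldType) (m : nat).
Implicit Types (a b k : multinom m) (f g : holo K m) (u v : multinom m -> K).

Lemma holoP f g : tcoef f =1 tcoef g -> f = g.
Proof.
case: f g => [f pf] [g pg] /= /funext efg; case: _ / efg pg => pg.
by congr Holo; apply: Prop_irrelevance.
Qed.

Lemma convergesS u (r s M : K) : 0 < s -> s <= r ->
  (forall a, `|u a| * r ^+ mdeg a <= M) ->
  forall a, `|u a| * s ^+ mdeg a <= M.
Proof.
move=> s0 sr uM a; apply: le_trans (uM a).
by rewrite ler_wpM2l// lerXn2r// nnegrE ltW// (lt_le_trans s0).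
Qed.

Lemma converges2 u v : converges u -> converges v ->
  exists r M : K, [/\ 0 < r, forall a, `|u a| * r ^+ mdeg a <= M
    & forall a, `|v a| * r ^+ mdeg a <= M].
Proof.
move=> [r [M [r0 uM]]] [s [N [s0 vN]]].
have M0 : 0 <= M by apply: le_trans (uM mnm0); rewrite mulr_ge0// exprn_ge0// ltW.
have N0 : 0 <= N by apply: le_trans (vN mnm0); rewrite mulr_ge0// exprn_ge0// ltW.
have [rs|sr] := real_leP (gtr0_real r0) (gtr0_real s0).
- exists r, (M + N); split=> // a.
    by apply: le_trans (uM a) _; rewrite lerDl.
  by apply: le_trans (convergesS r0 rs vN a) _; rewrite lerDr.
- exists s, (M + N); split=> // a; last first.
    by apply: le_trans (vN a) _; rewrite lerDr.
  by apply: le_trans (convergesS s0 (ltW sr) uM a) _; rewrite lerDl.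
Qed.

Definition ps_const (c : K) a : K := if a == mnm0 then c else 0.
Definition ps_add u v a := u a + v a.
Definition ps_opp u a := - u a.
Definition ps_mul u v a :=
  \sum_(k : bmultinom m (mdeg a).+1 | lem k a) u k * v (mnm_sub a k).
Definition ps_der (i : 'I_m) u a := (a i).+1%:R * u (mnm_add a (mnm1 i)).

Lemma converges_const c : converges (ps_const c).
Proof.
exists 1, `|c|; split=> // a; rewrite expr1n mulr1 /ps_const.
by case: ifP => // _; rewrite normr0.
Qed.

Lemma converges_add u v : converges u -> converges v -> converges (ps_add u v).
Proof.
move=> cu cv; have [r [M [r0 uM vM]]] := converges2 cu cv.
exists r, (M + M); split=> // a; apply: le_trans (lerD (uM a) (vM a)).
by rewrite -mulrDl ler_wpM2r ?ler_normD// exprn_ge0// ltW.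
Qed.

Lemma converges_opp u : converges u -> converges (ps_opp u).
Proof. by move=> [r [M [r0 uM]]]; exists r, M; split=> // a; rewrite normrN. Qed.

Lemma card_below (d : nat) : (#|{: bmultinom m d.+1}| <= (2 ^ m) ^ d)%N.
Proof.
pose h (k : bmultinom m d.+1) : {ffun 'I_m -> 'I_d.+1} := [ffun i => inord (k i)].
have hP (k : bmultinom m d.+1) i : (k i < d.+1)%N.
  apply: leq_ltn_trans (bmdeg k); rewrite mdegE (bigD1 i)//= leq_addr //.
have inj : injective h.
  move=> k l /ffunP e; apply/val_inj/mnmP => i.
  move: (e i); rewrite !ffunE => /(congr1 (@nat_of_ord _)).
  by rewrite !inordK.
apply: leq_trans (leq_card _ inj) _.
rewrite card_ffun !card_ord -expnM mulnC expnM.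
by have [->|m0] := posnP m; rewrite ?expn0// leq_exp2r// ltn_expl.
Qed.

Lemma converges_mul u v : converges u -> converges v -> converges (ps_mul u v).
Proof.
move=> cu cv; have [r [M [r0 uM vM]]] := converges2 cu cv.
have M0 : 0 <= M by apply: le_trans (uM mnm0); rewrite mulr_ge0// exprn_ge0// ltW.
pose q : K := (2 ^ m)%:R.
have q0 : 0 < q by rewrite ltr0n expn_gt0.
exists (r / q), (M * M); split=> [|a]; first by rewrite divr_gt0.
rewrite expr_div_n mulrA ler_pdivrMr ?exprn_gt0//.
apply: le_trans (_ : \sum_(k : bmultinom m (mdeg a).+1 | lem k a) M * M <= _).
  apply: le_trans (ler_wpM2r _ (ler_norm_sum _ _ _)) _.
    by rewrite exprn_ge0// ltW.
  rewrite mulr_suml; apply: ler_sum => k ka.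
  have -> : r ^+ mdeg a = r ^+ mdeg k * r ^+ mdeg (mnm_sub a k).
    by rewrite -exprD addnC -mdegD submK.
  by rewrite normrM mulrACA ler_pM ?mulr_ge0 ?exprn_ge0// ltW.
rewrite sumr_const -mulr_natr ler_wpM2l ?mulr_ge0//.
rewrite -natrX ler_nat; apply: leq_trans (max_card _) _; exact: card_below.
Qed.

Lemma converges_der i u : converges u -> converges (ps_der i u).
Proof.
move=> [r [M [r0 uM]]]; exists (r / 2), (M / r); split=> [|a].
  by rewrite divr_gt0.
rewrite expr_div_n mulrA ler_pdivrMr ?exprn_gt0// mulrAC ler_pdivlMr//.
rewrite /ps_der normrM normr_nat.
have uM' : `|u (mnm_add a (mnm1 i))| * r ^+ mdeg a * r <= M.
  by have := uM (mnm_add a (mnm1 i)); rewrite mdegD mdeg1 addn1 exprSr mulrA.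
rewrite -2!mulrA [leRHS]mulrC ler_pM ?ler0n//.
- by rewrite !mulr_ge0 ?exprn_ge0// ltW.
- rewrite -natrX ler_nat; apply: leq_trans (ltn_expl (a i) (isT : 1 < 2)%N) _.
  by rewrite leq_exp2l// mdegE (bigD1 i)//= leq_addr.
- by rewrite mulrA.
Qed.


Lemma tcoefP f : converges f. Proof. by case: f. Qed.

Definition holoC c : holo K m := Holo (converges_const c).
Definition holo_add f g := Holo (converges_add (tcoefP f) (tcoefP g)).
Definition holo_opp f := Holo (converges_opp (tcoefP f)).
Definition holo_mul f g := Holo (converges_mul (tcoefP f) (tcoefP g)).
Definition holo_der i f := Holo (converges_der i (tcoefP f)).

Let trunc N u : mpoly.mpoly m K := \sum_(k : bmultinom m N) u k *: mpoly.mpolyX K k.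

Let coef_trunc N u a : (mdeg a < N)%N -> mcoeff a (trunc N u) = u a.
Proof. by move=> aN; rewrite /trunc mcoeff_mpoly. Qed.

Let coefM (p q : mpoly.mpoly m K) a : mcoeff a (p * q) =
  \sum_(k : bmultinom m (mdeg a).+1 | lem k a)
    mcoeff k p * mcoeff (mnm_sub a k) q.
Proof. exact: mcoeff_poly_mul_lin. Qed.

Let coef_truncM N u v a : (mdeg a < N)%N ->
  mcoeff a (trunc N u * trunc N v) = ps_mul u v a.
Proof.
move=> aN; rewrite coefM.
apply: eq_bigr => k ka; rewrite !coef_trunc//.
  by apply: leq_ltn_trans aN; apply: mdegB.
by apply: leq_trans (bmdeg k) _.
Qed.

Let coef_mul_eq (p q p' q' : mpoly.mpoly m K) a :
  (forall k, lem k a -> mcoeff k p = mcoeff k p') ->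
  (forall k, lem k a -> mcoeff k q = mcoeff k q') ->
  mcoeff a (p * q) = mcoeff a (p' * q').
Proof.
move=> ep eq; rewrite !coefM.
by apply: eq_bigr => k ka; rewrite ep// eq// lem_subr.
Qed.

Let lem_mdeg a k : lem k a -> (mdeg k < (mdeg a).+1)%N.
Proof. by move=> ka; rewrite -(submK ka) mdegD ltnS leq_addl. Qed.

Lemma holo_addA : associative holo_add.
Proof. by move=> f g h; apply: holoP => a; apply: addrA. Qed.
Lemma holo_addC : commutative holo_add.
Proof. by move=> f g; apply: holoP => a; apply: addrC. Qed.
Lemma holo_add0 : left_id (holoC 0) holo_add.
Proof.
by move=> f; apply: holoP => a; rewrite /= /ps_add /ps_const if_same add0r.
Qed.
Lemma holo_addN : left_inverse (holoC 0) holo_opp holo_add.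
Proof.
by move=> f; apply: holoP => a; rewrite /= /ps_add /ps_const if_same addNr.
Qed.

HB.instance Definition _ := GRing.isZmodule.Build (holo K m)
  holo_addA holo_addC holo_add0 holo_addN.

Lemma holo_mulC : commutative holo_mul.
Proof.
move=> f g; apply: holoP => a /=.
by rewrite -!(@coef_truncM (mdeg a).+1)// mulrC.
Qed.

Lemma holo_mulA : associative holo_mul.
Proof.
move=> f g h; apply: holoP => a /=.
have E u v : forall k, lem k a -> mcoeff k (trunc (mdeg a).+1 (ps_mul u v)) =
    mcoeff k (trunc (mdeg a).+1 u * trunc (mdeg a).+1 v).
  by move=> k ka; rewrite coef_trunc ?coef_truncM// lem_mdeg.
rewrite -!(@coef_truncM (mdeg a).+1)//.
rewrite (coef_mul_eq (fun k _ => erefl) (E g h)).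
by rewrite (coef_mul_eq (E f g) (fun k _ => erefl)) mulrA.
Qed.

Lemma holo_mul1 : left_id (holoC 1) holo_mul.
Proof.
move=> f; apply: holoP => a /=; rewrite -(@coef_truncM (mdeg a).+1)//.
rewrite (@coef_mul_eq _ _ 1 (trunc (mdeg a).+1 f))//; last first.
  move=> k ka; rewrite coef_trunc ?lem_mdeg// mcoeff1 /ps_const.
  by case: eqP.
by rewrite mul1r coef_trunc.
Qed.

Lemma holo_mulD : left_distributive holo_mul holo_add.
Proof.
move=> f g h; apply: holoP => a /=.
rewrite /ps_add /ps_mul -big_split/=.
by apply: eq_bigr => k _; rewrite mulrDl.
Qed.

Lemma holo_1neq0 : holoC 1 != 0.
Proof.
apply/eqP => /(congr1 (fun f => tcoef f mnm0)) /eqP.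
by rewrite /= /ps_const eqxx oner_eq0.
Qed.

HB.instance Definition _ := GRing.Zmodule_isComNzRing.Build (holo K m)
  holo_mulA holo_mulC holo_mul1 holo_mulD holo_1neq0.

Lemma tcoef0 a : (0 : holo K m) a = 0.
Proof. by rewrite /= /ps_const if_same. Qed.
Lemma tcoefD f g a : (f + g) a = f a + g a. Proof. by []. Qed.
Lemma tcoefN f a : (- f) a = - f a. Proof. by []. Qed.
Lemma tcoefM f g a : (f * g) a = ps_mul f g a. Proof. by []. Qed.

Lemma holo_derD i f g : holo_der i (f + g) = holo_der i f + holo_der i g.
Proof. by apply: holoP => a; rewrite /= /ps_der /= /ps_add mulrDr. Qed.

Lemma holo_derM i f g : holo_der i (f * g) = holo_der i f * g + f * holo_der i g.
Proof.
apply: holoP => a; rewrite tcoefD !tcoefM /= /ps_der.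
pose N := (mdeg a).+2.
have E u k : lem k a -> mcoeff k (trunc N (ps_der i u)) =
    mcoeff k (mderiv i (trunc N u)).
  move=> /lem_mdeg ka; rewrite coef_trunc ?(leq_trans ka)//.
  by rewrite mcoeff_deriv coef_trunc ?mdegD ?mdeg1 ?addn1// /ps_der mulr_natl.
rewrite -!(@coef_truncM N)// ?mdegD ?mdeg1 ?addn1//.
rewrite mulr_natl -mcoeff_deriv mderivM mcoeffD; congr (_ + _).
  by apply: coef_mul_eq => k ka //; rewrite E.
by apply: coef_mul_eq => k ka //; rewrite E.
Qed.

Let holo_unit : pred (holo K m) := fun f => `[< exists g, g * f = 1 >].
Let holo_inv f := if pselect (exists g, g * f = 1) is left e
  then projT1 (cid e) else f.

Let holo_mulV : {in holo_unit, left_inverse 1 holo_inv *%R}.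
Proof.
move=> f /asboolP e; rewrite /holo_inv; case: pselect => // e'.
exact: projT2 (cid e').
Qed.

Let holo_unitP f g : g * f = 1 -> holo_unit f.
Proof. by move=> gf; apply/asboolP; exists g. Qed.

Let holo_inv_out : {in [predC holo_unit], holo_inv =1 id}.
Proof.
move=> f /negP nf; rewrite /holo_inv; case: pselect => // e.
by case: nf; apply/asboolP.
Qed.

HB.instance Definition _ := GRing.ComNzRing_hasMulInverse.Build (holo K m)
  holo_mulV holo_unitP holo_inv_out.

Let holo_lead f : f != 0 ->
  exists a, f a != 0 /\ forall b, (b < a)%O -> f b = 0.
Proof.
move=> f0; have [a fa] : exists a, f a != 0.
  apply: contra_notP (negP f0) => /forallNP fa; apply/eqP/holoP => a.
  by rewrite tcoef0; apply/eqP; apply: contra_notT (fa a).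
move: a fa; apply: ltmwf => a IH fa.
have [[b [ba fb]]|nb] := pselect (exists b, (b < a)%O /\ f b != 0).
  exact: IH ba fb.
exists a; split=> // b ba; apply/eqP; apply: contra_notT nb => fb.
by exists b.
Qed.

Lemma holo_integral f g : f * g = 0 -> (f == 0) || (g == 0).
Proof.
move=> fg0; have [//|/holo_lead[a [fa fmin]]] := eqVneq f 0.
have [//|/holo_lead[b [gb gmin]]] := eqVneq g 0.
have /eqP := congr1 (fun h => tcoef h (mnm_add a b)) fg0.
have aN : (mdeg a < (mdeg (mnm_add a b)).+1)%N by rewrite mdegD ltnS leq_addr.
rewrite tcoefM tcoef0 /ps_mul (bigD1 (BMultinom aN))/=; last exact: lem_addr.
rewrite big1 ?addr0 => [|k /andP[kab ka]].
  have -> : mnm_sub (mnm_add a b) a = b by rewrite addmC addmK.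
  by rewrite mulf_eq0 (negbTE fa) (negbTE gb).
case: (ltgtP (bmnm k) a) => [/fmin->|ak|e]; first by rewrite mul0r.
  rewrite [X in _ * X]gmin ?mulr0//.
  rewrite -(ltmc_add2l _ _ k) submK//.
  by rewrite (addmC b k) ltmc_add2l.
by move: ka; rewrite bmeqP/= e eqxx.
Qed.

HB.instance Definition _ :=
  GRing.ComUnitRing_isIntegral.Build (holo K m) holo_integral.

End Ring.

Notation mero K m := {fraction (holo K m)}.
Notation "x %:F" := (@FracField.tofrac _ x) : ring_scope.

Lemma fracE (A : idomainType) (x : {fraction A}) :
  x = (frac (repr x)).1%:F / (frac (repr x)).2%:F.
Proof.
rewrite -{1}[x]reprK; set r := repr x.
have r0 : r.2 != 0 := denom_ratioP _.
unlock FracField.tofrac.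
rewrite -[X in _ * X]FracField.pi_inv -[RHS]FracField.pi_mul.
rewrite /FracField.mulf /FracField.invf !numden_Ratio ?oner_neq0//.
by rewrite mulr1 mul1r Ratio_numden.
Qed.

(* The quotient rule applied to a representative p/q; mero_derE shows that the
   result does not depend on the representative. *)
Definition mero_der (K : numFieldType) m (i : 'I_m) (x : mero K m) : mero K m :=
  let: (p, q) := frac (repr x) in
  (holo_der i p * q - p * holo_der i q)%:F / (q ^+ 2)%:F.

Lemma mero_derE (K : numFieldType) m (i : 'I_m) (p q : holo K m) : q != 0 ->
  mero_der i (p%:F / q%:F) =
  (holo_der i p * q - p * holo_der i q)%:F / (q ^+ 2)%:F.
Proof.
move=> q0; rewrite /mero_der; set x := p%:F / q%:F.
have d0 : (frac (repr x)).2 != 0 := denom_ratioP _.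
have : x = (frac (repr x)).1%:F / (frac (repr x)).2%:F := fracE x.
case: (frac (repr x)) d0 => n d /= d0 e.
have q0' : q%:F != 0 by rewrite tofrac_eq0.
have d0' : d%:F != 0 by rewrite tofrac_eq0.
have pn : n * q = p * d.
  apply/eqP; rewrite -tofrac_eq !tofracM.
  by move/eqP: e; rewrite eqr_div// => /eqP ->.
have dpn : holo_der i n * q + n * holo_der i q = holo_der i p * d + p * holo_der i d.
  by rewrite -!holo_derM pn.
apply/eqP; rewrite eqr_div ?tofrac_eq0 ?expf_neq0// -!tofracM tofrac_eq.
apply/eqP/subr0_eq.
transitivity (d * q * (holo_der i n * q + n * holo_der i q
    - (holo_der i p * d + p * holo_der i d))
  - (n * q - p * d) * (d * holo_der i q + holo_der i d * q)).
  by ring.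
by rewrite pn dpn !subrr mulr0 mul0r subrr.
Qed.

Section Forms.
Variables (A : nzRingType) (m : nat) (D : 'I_m -> A -> A).

Definition diff0 (f : A) : 'rV[A]_m := \row_i D i f.
Definition diff1 (w : 'rV[A]_m) : 'M[A]_m :=
  \matrix_(i, j) (D i (w 0 j) - D j (w 0 i)).
Definition wedge11 (v w : 'rV[A]_m) : 'M[A]_m :=
  \matrix_(i, j) (v 0 i * w 0 j - v 0 j * w 0 i).
Definition wedge12 (w : 'rV[A]_m) (t : 'M[A]_m) (i j k : 'I_m) : A :=
  w 0 i * t j k - w 0 j * t i k + w 0 k * t i j.

Definition integrable_form (w : 'rV[A]_m) :=
  forall i j k, wedge12 w (diff1 w) i j k = 0.
End Forms.

Definition dholo K m (f : holo K m) : 'rV[holo K m]_m :=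
  diff0 (@holo_der K m) f.
Definition dmero K m (h : mero K m) : 'rV[mero K m]_m :=
  diff0 (@mero_der K m) h.
Definition to_mero K m (w : 'rV[holo K m]_m) : 'rV[mero K m]_m :=
  map_mx (fun f => f%:F) w.

Definition irreducible_elt (A : unitRingType) (f : A) :=
  [/\ f != 0, f \isn't a GRing.unit &
    forall g h, f = g * h -> g \is a GRing.unit \/ h \is a GRing.unit].

Definition reduced_elt (A : unitRingType) (f : A) :=
  f != 0 /\ forall g h, f = g ^+ 2 * h -> g \is a GRing.unit.

Section Deformations.
Variables (K : numFieldType) (m : nat).

Definition value0 (f : holo K m) : K := f mnm0.

Definition general_position (f g : holo K m) :=
  [/\ value0 f = 0, value0 g = 0 &
    wedge11 (map_mx value0 (dholo f)) (map_mx value0 (dholo g)) != 0].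

(* W_t = \sum_k t^k w_k for t near 0, where the Taylor series in (x, t)
   converges on a polydisc around 0 in K^m x K. Only the values of W near 0
   matter. *)
Definition analytic_family (W : K -> 'rV[holo K m]_m)
    (w : nat -> 'rV[holo K m]_m) :=
  (exists r M : K, 0 < r /\
     forall k i a, `|w k 0 i a| * r ^+ (k + mdeg a) <= M) /\
  \forall t \near (0 : K), forall i a,
     (series (fun k => t ^+ k * w k 0 i a) @ \oo --> W t 0 i a)%classic.

Definition integrable_deformation (W : K -> 'rV[holo K m]_m)
    (w : nat -> 'rV[holo K m]_m) :=
  analytic_family W w /\
  \forall t \near (0 : K), integrable_form (@holo_der K m) (W t).

End Deformations.

(* A formal power series in t is the sequence of its coefficients. *)
Section FormalSeries.
Variable A : nzRingType.

(* The factors with k > n do not contribute to the coefficient of t^n in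
   \prod_(k >= 1) (1 + t^k a_k). *)
Definition fps_prod1 (a : nat -> A) (n : nat) : A :=
  (\prod_(1 <= k < n.+1) (1 + a k *: 'X^k))`_n.

Definition fps_scale (V : lmodType A) (u : nat -> A) (w : nat -> V) (n : nat) : V :=
  \sum_(k < n.+1) u (n - k)%N *: w k.

End FormalSeries.

Definition diophantine (R : realType) (lam : Cplx R) :=
  exists c delta : R, [/\ 0 < c, 0 <= delta &
    forall i j : int, (i, j) != (0, 0) ->
      (c / (`|i| + `|j|)%:~R `^ delta)%:C%C <= `|lam * i%:~R + j%:~R|].

(* Main.v *)
Require Import Defs.
From HB Require Import structures.
From mathcomp Require Import all_boot all_order all_algebra.
From mathcomp Require Import boolp classical_sets reals topology normedtype.
From mathcomp Require Import sequences exp complex ring zify.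
From mathcomp.multinomials Require mpoly.
Import -(notations) mpoly.
Set Implicit Arguments.
Unset Strict Implicit.
Unset Printing Implicit Defensive.
Import Order.TTheory GRing.Theory Num.Theory numFieldNormedType.Exports.
Local Open Scope ring_scope.

(** The deformation is put into normal form one power of t at a time. Suppose that
    up to order n - 1 it is F G U eta, with U a unit and
    eta = alpha dF/F + dG/G + dH a closed form. At order n there is an error
    t^n xi, where xi is a meromorphic form with poles on F G = 0 only. The
    integrability condition does not see the factor F G U, and the forms eta and
    omega0 = eta_0 = dG/G - lam dF/F are closed; its coefficient of t^n therefore
    reads omega0 /\ d xi = 0 ([obstruction_closed]). All that is needed is that
    such a relatively closed form can be written
       xi = a omega0 + kappa dF/F + dh,
    with a and h having poles on F G = 0 only ([relative_cohomology]): then a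
    corrects the unit, kappa corrects alpha and h corrects H ([normal_upto_step]).
    The series beta stays equal to 1.

    The relative cohomology is computed in coordinates x = F, y = G, z. The fields
    X = x d_x + lam y d_y and the d_z span the kernel of omega0 and commute.
    Relative closedness means that A = xi(X) and the functions C = xi(d_z) satisfy
    X C = d_z A and the compatibility conditions among the C, and one looks for a
    primitive along these fields: X h = A - kappa, d_z h = C ([frame_tangent],
    [frame_closed], [frame_decomp]). The monomials
    x^p y^q z^r are eigenvectors of X, of eigenvalue p + lam q. When it is nonzero
    one divides by it, and the Diophantine condition keeps the series convergent;
    when it is zero, that is for p = q = 0, the coefficient of A is a constant
    kappa and h is found by integrating C ([model_solve]). The value a is then what
    is left on a field transverse to omega0.

    Working in the coordinates (F, G, z) requires the inverse function theorem for
    convergent power series. It is obtained in the following form. Composition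
    with the coordinates is an injective morphism of rings intertwining the
    partial derivatives with the dual frame of vector fields D ([fder_comp],
    [holo_comp_inj]); its inverse sends f to the series of the D^a f(0) / a!,
    whose convergence follows from Cauchy estimates in weighted l1 norms
    ([converges_taylor], [taylorK]).

    Finally, integrability is assumed for each small t, and has to be read on the
    coefficients of t: asymptotic expansions in t are multiplicative and unique
    ([jet_integrable]). *)

(** * l1 estimates for power series *)

Section Weights.
Variables (K : numFieldType) (m : nat).
Implicit Types (u v : multinom m -> K) (a b k : multinom m) (s M : K).

Lemma ler_sum_inj (I J : finType) (h : I -> J) (G : J -> K) :
  injective h -> (forall j, 0 <= G j) -> \sum_i G (h i) <= \sum_j G j.
Proof.
move=> hinj G0.
have -> : \sum_i G (h i) = \sum_(j in [set h i | i : I]) G j.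
  rewrite big_imset //=.
  by move=> x y _ _; apply: hinj.
rewrite [leRHS](bigID (fun j => j \in [set h i | i : I]))/=.
by rewrite lerDl sumr_ge0.
Qed.

(** The weighted l1 norm of u at radius s is at most M. Unlike sup bounds on the
    coefficients, these bounds multiply without loss, so that they pass to
    powers of arbitrary order. *)
Definition l1_le s M u :=
  forall N, \sum_(k : bmultinom m N) `|u k| * s ^+ mdeg k <= M.

Lemma l1_le_coef s M u a : 0 <= s -> l1_le s M u -> `|u a| * s ^+ mdeg a <= M.
Proof.
move=> s0 /(_ (mdeg a).+1); apply: le_trans.
rewrite (bigD1 (BMultinom (ltnSn (mdeg a))))//= lerDl sumr_ge0// => k _.
by rewrite mulr_ge0// exprn_ge0.
Qed.

Lemma l1_le_ge0 s M u : 0 <= s -> l1_le s M u -> 0 <= M.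
Proof.
by move=> s0 /(l1_le_coef mnm0 s0); apply: le_trans; rewrite mulr_ge0 ?exprn_ge0.
Qed.

Lemma l1_le_converges s M u : 0 < s -> l1_le s M u -> converges u.
Proof. by move=> s0 uM; exists s, M; split=> // a; apply: l1_le_coef (ltW s0) uM. Qed.

Lemma sum_half (N : nat) : \sum_(j < N) (2^-1 : K) ^+ j <= 2.
Proof.
suff : \sum_(j < N) (2^-1 : K) ^+ j + 2 * 2^-1 ^+ N = 2.
  by move=> e; rewrite -[leRHS]e lerDl mulr_ge0// exprn_ge0// invr_ge0.
elim: N => [|N IH]; first by rewrite big_ord0 expr0 mulr1 add0r.
apply: etrans IH; rewrite big_ord_recr/= -addrA; congr (_ + _).
by rewrite exprS mulrA mulfV ?pnatr_eq0// mul1r -[2]/(1 + 1) mulrDl mul1r.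
Qed.

(** The sum is part of the product over the variables of m geometric series. *)
Lemma sum_half_mdeg (N : nat) :
  \sum_(k : bmultinom m N) (2^-1 : K) ^+ mdeg k <= 2 ^+ m.
Proof.
pose h (k : bmultinom m N) : {ffun 'I_m -> 'I_N.+1} := [ffun i => inord (k i)].
have hP (k : bmultinom m N) i : (k i < N.+1)%N.
  apply: leq_trans (leqW (bmdeg k)); rewrite ltnS mdegE (bigD1 i)//= leq_addr //.
have inj : injective h.
  move=> k l /ffunP e; apply/val_inj/mnmP => i.
  move: (e i); rewrite !ffunE => /(congr1 (@nat_of_ord _)).
  by rewrite !inordK.
pose G (f : {ffun 'I_m -> 'I_N.+1}) : K := \prod_i 2^-1 ^+ (f i).
apply: le_trans (_ : \sum_f G f <= _).
  apply: le_trans (ler_sum_inj inj _); last first.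
    by move=> f; apply: prodr_ge0 => i _; rewrite exprn_ge0// invr_ge0.
  apply: ler_sum => k _; rewrite le_eqVlt; apply/orP; left; apply/eqP.
  rewrite /G mdegE -prodrXr; apply: eq_bigr => i _.
  by rewrite ffunE inordK.
rewrite /G -(bigA_distr_bigA (fun _ (j : 'I_N.+1) => (2^-1 : K) ^+ j))/=.
rewrite prodr_const card_ord lerXn2r ?nnegrE ?sum_half ?ler0n//.
by rewrite sumr_ge0// => i _; rewrite exprn_ge0// invr_ge0.
Qed.

Lemma converges_l1_le u : converges u -> exists s M, 0 < s /\ l1_le s M u.
Proof.
move=> [r [M [r0 uM]]]; exists (r / 2), (M * 2 ^+ m).
split=> [|N]; first by rewrite divr_gt0.
have M0 : 0 <= M by apply: le_trans (uM mnm0); rewrite mulr_ge0// exprn_ge0// ltW.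
apply: le_trans (ler_wpM2l M0 (sum_half_mdeg N)).
rewrite mulr_sumr; apply: ler_sum => k _.
by rewrite exprMn mulrA ler_wpM2r// exprn_ge0// invr_ge0.
Qed.

Lemma l1_le_le s s' M M' u : 0 <= s' -> s' <= s -> M <= M' ->
  l1_le s M u -> l1_le s' M' u.
Proof.
move=> s0 ss MM uM N; apply: le_trans (le_trans (uM N) MM).
apply: ler_sum => k _; rewrite ler_wpM2l// lerXn2r// nnegrE//.
exact: le_trans ss.
Qed.

(** Without constant term every monomial carries at least one factor of the
    radius, so shrinking it by e gains a factor e. Hence such a series can be
    made smaller than any given radius of convergence, and substituted. *)
Lemma l1_le_shrink s M u e : 0 <= s -> 0 <= e -> e <= 1 -> u mnm0 = 0 ->
  l1_le s M u -> l1_le (e * s) (e * M) u.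
Proof.
move=> s0 e0 e1 u0 uM N; apply: le_trans (ler_wpM2l e0 (uM N)).
rewrite mulr_sumr; apply: ler_sum => k _.
have [/eqP|] := eqVneq (mdeg k) 0%N.
  by rewrite mdeg_eq0 => /eqP ->; rewrite u0 normr0 !mul0r mulr0.
case: (mdeg k) => // d _; rewrite mulrCA ler_wpM2l// exprMn.
rewrite ler_wpM2r ?exprn_ge0// exprS -[leRHS]mulr1 ler_wpM2l//.
by rewrite exprn_ile1.
Qed.

Lemma l1_le_add s M N u v : 0 <= s -> l1_le s M u -> l1_le s N v ->
  l1_le s (M + N) (ps_add u v).
Proof.
move=> s0 uM vN n; apply: le_trans (lerD (uM n) (vN n)).
rewrite -big_split/=; apply: ler_sum => k _.
by rewrite -mulrDl ler_wpM2r ?exprn_ge0// ler_normD.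
Qed.

Lemma l1_le_const s c : l1_le s `|c| (ps_const c).
Proof.
case=> [|N]; first by rewrite big1// => k; have := bmdeg k; rewrite ltn0.
have k0 : (mdeg (@mnm0 m) < N.+1)%N by rewrite mdeg0.
rewrite (bigD1 (BMultinom k0))//= big1 ?addr0.
  by rewrite /ps_const eqxx mdeg0 mulr1.
by move=> k; rewrite /ps_const bmeqP/= => /negbTE ->; rewrite normr0 mul0r.
Qed.

Definition trunc (R : nzRingType) N (u : multinom m -> R) : mpoly m R :=
  \sum_(k : bmultinom m N) u k *: mpolyX R k.

Lemma trunc_coef (R : nzRingType) N (u : multinom m -> R) a :
  mcoeff a (trunc N u) = if (mdeg a < N)%N then u a else 0.
Proof.
rewrite /trunc; case: ifPn => [aN|]; first by rewrite mcoeff_mpoly.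
rewrite -leqNgt => aN; rewrite raddf_sum big1// => k _ /=.
rewrite mcoeffZ mcoeffX; case: eqP => [e|]; last by rewrite mulr0.
by have := bmdeg k; rewrite e ltnNge aN.
Qed.

Lemma lem_mdeg a k : lem k a -> (mdeg k <= mdeg a)%N.
Proof. by move=> ka; rewrite -(submK ka) mdegD leq_addl. Qed.

Lemma trunc_mul N u v a : (mdeg a < N)%N ->
  mcoeff a (trunc N u * trunc N v) = ps_mul u v a.
Proof.
move=> aN; rewrite (mcoeff_poly_mul_lin _ _ (ltnSn (mdeg a))).
apply: eq_bigr => k ka; rewrite !trunc_coef.
by rewrite !(leq_ltn_trans (lem_mdeg _) aN)// lem_subr.
Qed.

(** For the polynomials obtained by truncation at order n, with coefficients
    replaced by their weighted norms, the l1 norm is evaluation at (1, .., 1),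
    which is multiplicative. *)
Lemma l1_le_mul s M N u v : 0 <= s -> l1_le s M u -> l1_le s N v ->
  l1_le s (M * N) (ps_mul u v).
Proof.
move=> s0 uM vN n.
pose w (f : multinom m -> K) a := `|f a| * s ^+ mdeg a.
have w0 f a : 0 <= w f a by rewrite mulr_ge0// exprn_ge0.
have E (f : multinom m -> K) : \sum_(k : bmultinom m n) `|f k| * s ^+ mdeg k
    = meval (fun=> 1) (trunc n (w f)).
  rewrite /trunc raddf_sum/=; apply: eq_bigr => k _.
  by rewrite mevalZ mevalX big1 ?mulr1// => i _; rewrite expr1n.
have posE (p : mpoly m K) : (forall a, 0 <= mcoeff a p) -> 0 <= meval (fun=> 1) p.
  move=> p0; rewrite mevalE sumr_ge0// => k _.
  by rewrite mulr_ge0// prodr_ge0// => i _; rewrite expr1n.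
apply: le_trans (ler_pM _ _ (uM n) (vN n)).
2,3: by apply: sumr_ge0 => k _; apply: (w0 _ k).
rewrite !E.
rewrite -rmorphM/= -subr_ge0 -raddfB/=; apply: posE => a.
rewrite mcoeffB trunc_coef; case: ifPn => [an|_]; last first.
  rewrite subr0 (mcoeff_poly_mul_lin _ _ (ltnSn (mdeg a))) sumr_ge0// => k _.
  by rewrite !trunc_coef mulr_ge0//; case: ifP.
rewrite trunc_mul// subr_ge0 /w /ps_mul.
apply: le_trans (ler_wpM2r _ (ler_norm_sum _ _ _)) _; first exact: exprn_ge0.
rewrite mulr_suml; apply: ler_sum => k ka.
rewrite normrM mulrACA -exprD -mdegD addmC submK// lexx.
Qed.

(** A Cauchy estimate: the loss of radius s - s' costs a factor 1 / (s - s'). *)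
Lemma l1_le_der s s' M i u : 0 < s' -> s' < s -> l1_le s M u ->
  l1_le s' (M / (s - s')) (ps_der i u).
Proof.
move=> s'0 ss uM N.
have d0 : 0 < s - s' by rewrite subr_gt0.
have s0 : 0 < s := lt_trans s'0 ss.
rewrite ler_pdivlMr//; apply: le_trans (uM N.+1).
have hP (k : bmultinom m N) : (mdeg (mnm_add k (mnm1 i)) < N.+1)%N.
  by rewrite mdegD mdeg1 addn1 ltnS; apply: bmdeg.
pose h (k : bmultinom m N) := BMultinom (hP k).
have hinj : injective h.
  by move=> k l /(congr1 (@bmnm _ _))/= e; apply/val_inj/(@addIm _ (mnm1 i)).
pose G (k : bmultinom m N.+1) : K := `|u k| * s ^+ mdeg k.
apply: le_trans (ler_sum_inj (G := G) hinj _); last first.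
  by move=> k; rewrite mulr_ge0// exprn_ge0// ltW.
rewrite mulr_suml; apply: ler_sum => k _.
rewrite /ps_der normrM normr_nat /G /= mdegD mdeg1 addn1.
rewrite [_%:R * _]mulrC -!mulrA ler_wpM2l//.
apply: le_trans (_ : (mdeg k).+1%:R * (s' ^+ mdeg k * (s - s')) <= _).
  apply: ler_wpM2r; first by rewrite mulr_ge0 ?exprn_ge0 ?(ltW d0) ?(ltW s'0).
  by rewrite ler_nat ltnS mdegE (bigD1 i)//= leq_addr.
(* n s'^(n-1) (s - s') is at most s^n - s'^n, hence at most s^n. *)
elim: (mdeg k) => [|d IH].
  by rewrite expr0 !mul1r expr1 gerBl ltW.
rewrite -natr1 mulrDl mul1r exprS -[in X in X + _]mulrA mulrCA.
rewrite [s ^+ d.+2]exprS.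
have -> : s * s ^+ d.+1 = s' * s ^+ d.+1 + (s - s') * s ^+ d.+1.
  by rewrite -mulrDl addrC subrK.
rewrite lerD//; first by rewrite ler_wpM2l// ltW.
by rewrite -exprS mulrC ler_wpM2l ?(ltW d0)// lerXn2r// ?nnegrE ltW.
Qed.

End Weights.

(** * Germs, monomials and orders of vanishing *)

Section Holo.
Variables (K : numFieldType) (m : nat).
Implicit Types (f g : holo K m) (a b k e : multinom m) (c : K).

Lemma mdeg_subK a b : lem b a -> (mdeg (mnm_sub a b) + mdeg b)%N = mdeg a.
Proof. by move=> ba; rewrite -mdegD submK. Qed.

Lemma tcoefM_single e f g a : (forall b, b != e -> f b = 0) ->
  (f * g) a = if lem e a then f e * g (mnm_sub a e) else 0.
Proof.
move=> fe; rewrite tcoefM /ps_mul; case: ifPn => ea.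
  have eN : (mdeg e < (mdeg a).+1)%N by rewrite ltnS lem_mdeg.
  rewrite (bigD1 (BMultinom eN))//= big1 ?addr0// => k /andP[_].
  by rewrite bmeqP/= => /fe ->; rewrite mul0r.
rewrite big1// => k ka; rewrite fe ?mul0r//.
by apply: contraNneq ea => <-.
Qed.

Lemma tcoefCM c f a : (holoC m c * f) a = c * f a.
Proof.
rewrite (@tcoefM_single mnm0)/= ?subm0; last first.
  by move=> b /negbTE b0; rewrite /= /ps_const b0.
by rewrite /ps_const eqxx; case: mnm_lepP => // -[] i; rewrite mnm0E.
Qed.

Lemma holoC_zmod_morphism : zmod_morphism (@holoC K m).
Proof.
move=> c d; apply: holoP => a; rewrite /= /ps_add /ps_opp /ps_const /=.
by case: eqP => _; rewrite ?subr0.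
Qed.

Lemma holoC_monoid_morphism : monoid_morphism (@holoC K m).
Proof.
split=> // c d; apply: holoP => a; rewrite tcoefCM /= /ps_const.
by case: eqP => _; rewrite ?mulr0.
Qed.

HB.instance Definition _ :=
  GRing.isZmodMorphism.Build K (holo K m) (@holoC K m) holoC_zmod_morphism.
HB.instance Definition _ :=
  GRing.isMonoidMorphism.Build K (holo K m) (@holoC K m) holoC_monoid_morphism.

Definition ps_mon e a : K := (a == e)%:R.

Lemma converges_mon e : converges (ps_mon e).
Proof.
exists 1, 1; split=> // a; rewrite expr1n mulr1 /ps_mon.
by case: eqP => _; rewrite ?normr1 ?normr0.
Qed.

Definition holo_mon e : holo K m := Holo (converges_mon e).

Lemma tcoef_monM e f a :
  (holo_mon e * f) a = if lem e a then f (mnm_sub a e) else 0.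
Proof.
rewrite (@tcoefM_single e)/= /ps_mon ?eqxx ?mul1r//.
by move=> b /negbTE ->.
Qed.

Lemma holo_monD e e' : holo_mon (mnm_add e e') = holo_mon e * holo_mon e'.
Proof.
apply: holoP => a; rewrite tcoef_monM /= /ps_mon.
case: ifPn => [ea|nea].
  congr (nat_of_bool _)%:R; apply/eqP/eqP => [->|<-].
    by rewrite addmC addmK.
  by rewrite addmC submK.
by case: eqP => // ae; rewrite ae lem_addr in nea.
Qed.

Lemma tcoef_sum I (r : seq I) (P : pred I) (F : I -> holo K m) a :
  (\sum_(i <- r | P i) F i) a = \sum_(i <- r | P i) F i a.
Proof.
by apply: (big_morph (fun f : holo K m => f a)) => [f g|]; rewrite ?tcoef0.
Qed.

Lemma value0M f g : value0 (f * g) = value0 f * value0 g.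
Proof.
rewrite /value0 tcoefM /ps_mul.
have N0 : (mdeg (@mnm0 m) < (mdeg (@mnm0 m)).+1)%N by [].
rewrite (bigD1 (BMultinom N0))//= ?big1 ?addr0 ?sub0m// => [k /andP[k0 kn]|].
  move: kn; rewrite bmeqP/= -mdeg_eq0 -leqn0.
  by have := lem_mdeg k0; rewrite [X in (_ <= X)%N]mdeg0 => ->.
exact: lepm_refl.
Qed.

Lemma holo_der_additive i : zmod_morphism (@holo_der K m i).
Proof.
move=> f g; apply: holoP => a; rewrite /= /ps_der /ps_add /ps_opp /=.
by rewrite /ps_add /ps_opp mulrBr.
Qed.

HB.instance Definition _ i :=
  GRing.isZmodMorphism.Build (holo K m) (holo K m) (@holo_der K m i)
    (holo_der_additive i).

Lemma holo_derC i c : holo_der i (holoC m c) = 0.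
Proof.
apply: holoP => a; rewrite tcoef0 /= /ps_der /= /ps_const.
by rewrite mnmD_eq0 mnm1_eq0 andbF mulr0.
Qed.

Lemma holo_der_mon1 i j : holo_der i (holo_mon (mnm1 j)) = (i == j)%:R.
Proof.
apply: holoP => a.
have -> : ((i == j)%:R : holo K m) a = (i == j)%:R * ps_const 1 a.
  by case: eqP => _; rewrite ?mul1r// mul0r tcoef0.
rewrite /= /ps_der /= /ps_mon /ps_const.
have [->|ij] := eqVneq i j.
  rewrite -{2}[mnm1 j]add0m (can_eq (addmK _)) mul1r.
  by case: eqP => [->|]; rewrite ?mulr0// mnm0E mulr1.
rewrite mul0r; case: eqP => [/mnmP/(_ i)|]; last by rewrite mulr0.
by rewrite mnmDE !mnm1E eqxx addn1 eq_sym (negbTE ij).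
Qed.

Lemma holo_derAC i j f : holo_der i (holo_der j f) = holo_der j (holo_der i f).
Proof.
apply: holoP => a; rewrite /= /ps_der /= /ps_der !mnmDE !mnm1E.
rewrite -!addmA [mnm_add (mnm1 i) _]addmC.
have [->//|ij] := eqVneq i j.
by rewrite !addn0 mulrCA.
Qed.

(** Membership in the d-th power of the maximal ideal. *)
Definition vanish d f := forall a, (mdeg a < d)%N -> f a = 0.

Lemma vanishM (d e : nat) f g : vanish d f -> vanish e g -> vanish (d + e) (f * g).
Proof.
move=> fd ge a ade; rewrite tcoefM /ps_mul big1// => k ka.
have [/fd->|dk] := ltnP (mdeg k) d; first by rewrite mul0r.
rewrite ge ?mulr0//.
by have := mdeg_subK ka; lia.
Qed.

Lemma vanish1 f : vanish 1 f <-> value0 f = 0.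
Proof.
split=> [f0|f0 a]; first by apply: f0; rewrite mdeg0.
by rewrite ltnS leqn0 mdeg_eq0 => /eqP ->.
Qed.

Lemma vanish_prod n (U : 'I_n -> holo K m) : (forall i, value0 (U i) = 0) ->
  forall a : multinom n, vanish (mdeg a) (mmap1 U a).
Proof.
move=> U0 a; rewrite mdegE /mmap1.
elim/big_ind2: _ => [//|d f e g|i _]; first exact: vanishM.
elim: (a i) => [//|d IH]; rewrite exprS -add1n.
by apply: vanishM => //; apply/vanish1.
Qed.

End Holo.

(** * Composition with germs vanishing at the origin *)

Section Composition.
Variables (K : numFieldType) (n m : nat).
Implicit Types (f : holo K m) (g : holo K n) (a : multinom n) (b : multinom m).

Lemma common_l1_le (I : finType) (V : I -> holo K m) :
  exists s M : K, [/\ 0 < s, 0 <= M & forall i, l1_le s M (V i)].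
Proof.
have /choice[p pP] (i : I) : exists p : K * K, 0 < p.1 /\ l1_le p.1 p.2 (V i).
  by have [s [M sM]] := converges_l1_le (tcoefP (V i)); exists (s, M).
have M0 i : 0 <= (p i).2 by have [s0] := pP i; apply: l1_le_ge0; apply: ltW.
have S0 : 0 < \sum_i (p i).1^-1 + 1.
  by rewrite ltr_wpDl// sumr_ge0// => i _; rewrite invr_ge0 ltW//; case: (pP i).
exists (\sum_i (p i).1^-1 + 1)^-1, (\sum_i (p i).2); split.
- by rewrite invr_gt0.
- by apply: sumr_ge0.
move=> i; have [s0] := pP i; apply: l1_le_le.
- by rewrite invr_ge0 ltW.
- rewrite -[leRHS]invrK lef_pV2 ?posrE ?invr_gt0//.
  rewrite (bigD1 i)//= -addrA lerDl addr_ge0// sumr_ge0// => j _.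
  by rewrite invr_ge0 ltW//; case: (pP j).
- by rewrite (bigD1 i)//= lerDl sumr_ge0.
Qed.

Lemma l1_le_sum s (I : Type) (r : seq I) (V : I -> holo K m) (M : I -> K) :
  0 <= s -> (forall i, l1_le s (M i) (V i)) ->
  l1_le s (\sum_(i <- r) M i) (\sum_(i <- r) V i).
Proof.
move=> s0 VM; elim/big_ind2: _ => // [|M1 f1 M2 f2]; last exact: l1_le_add.
by have := @l1_le_const K m s 0; rewrite normr0.
Qed.

Variable U : 'I_n -> holo K m.
Hypothesis U0 : forall i, value0 (U i) = 0.

Lemma l1_le_mmap1 s r a : 0 <= s -> (forall i, l1_le s r (U i)) ->
  l1_le s (r ^+ mdeg a) (mmap1 U a).
Proof.
move=> s0 UM.
have one : l1_le s 1 (1 : holo K m).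
  by have := @l1_le_const K m s 1; rewrite normr1.
rewrite mdegE -prodrXr /mmap1.
elim/big_ind2: _ => // [M1 f1 M2 f2|i _]; first exact: l1_le_mul.
elim: (a i) => [//|d IH]; rewrite !exprS; exact: l1_le_mul.
Qed.

Lemma small_l1_le (r : K) : 0 < r ->
  exists s : K, 0 < s /\ forall i, l1_le s r (U i).
Proof.
move=> r0; have [s [M [s0 M0 UM]]] := common_l1_le U.
have Mr : 0 < M + r by rewrite ltr_wpDl.
exists (r / (M + r) * s); split=> [|i]; first by rewrite mulr_gt0// divr_gt0.
apply: (@l1_le_le _ _ (r / (M + r) * s) _ (r / (M + r) * M)) => //.
- by rewrite mulr_ge0 ?divr_ge0// ?ltW.
- by rewrite mulrAC ler_pdivrMr// ler_pM2l// lerDl ltW.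
apply: l1_le_shrink => //; first exact: ltW.
- by rewrite divr_ge0// ltW.
- by rewrite ler_pdivrMr// mul1r lerDr.
- exact: U0.
Qed.

(** Since U^a vanishes at order |a|, a coefficient of the composition involves
    only a truncation of g; every property of composition thus reduces to the
    case of polynomials. *)
Definition pcomp (p : mpoly n K) : holo K m := mmap (@holoC K m) U p.

Lemma pcomp_vanish d (p : mpoly n K) :
  (forall a, (mdeg a < d)%N -> mcoeff a p = 0) -> vanish d (pcomp p).
Proof.
move=> pd b bd; rewrite /pcomp /mmap tcoef_sum big1_seq// => a _.
rewrite tcoefCM; have [/pd->|da] := ltnP (mdeg a) d; first by rewrite mul0r.
by rewrite (vanish_prod U0) ?mulr0// (leq_trans bd).
Qed.

Lemma pcomp_eq N (p q : mpoly n K) b : (mdeg b < N)%N ->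
  (forall a, (mdeg a < N)%N -> mcoeff a p = mcoeff a q) ->
  pcomp p b = pcomp q b.
Proof.
move=> bN pq; apply/subr0_eq.
have <- : pcomp (p - q) b = pcomp p b - pcomp q b.
  by rewrite /pcomp mmapB.
apply: (@pcomp_vanish N) => // a aN.
by rewrite mcoeffB pq// subrr.
Qed.

Definition ps_comp (u : multinom n -> K) b : K := pcomp (trunc (mdeg b).+1 u) b.

Lemma ps_compE N (u : multinom n -> K) b : (mdeg b < N)%N ->
  ps_comp u b = pcomp (trunc N u) b.
Proof.
move=> bN; apply: (pcomp_eq (N := (mdeg b).+1)) => // a ab.
by rewrite !trunc_coef ab (leq_trans ab bN).
Qed.

(** If the U i have norm at most r at radius s, then U^a has norm at most r^|a|,
    and the norm of g at radius r dominates that of the composition. *)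
Lemma l1_le_comp s r M u : 0 <= s -> (forall i, l1_le s r (U i)) -> l1_le r M u ->
  l1_le s M (ps_comp u).
Proof.
move=> s0 UM uM N; under eq_bigr => k _ do rewrite (ps_compE u (bmdeg k)).
apply: le_trans (uM N).
have -> : pcomp (trunc N u) =
    \sum_(k : bmultinom n N) holoC m (u k) * mmap1 U k.
  rewrite /pcomp /trunc raddf_sum/=; apply: eq_bigr => k _.
  by rewrite mmapZ mmapX.
apply: (@l1_le_sum s _ _ (fun k : bmultinom n N => holoC m (u k) * mmap1 U k)) => // k.
apply: l1_le_mul => //; first exact: l1_le_const.
exact: l1_le_mmap1.
Qed.

Lemma converges_comp g : converges (ps_comp g).
Proof.
have [r [M [r0 gM]]] := converges_l1_le (tcoefP g).
have [s [s0 UM]] := small_l1_le r0.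
exact: l1_le_converges (l1_le_comp (ltW s0) UM gM).
Qed.

Definition holo_comp g : holo K m := Holo (converges_comp g).

Lemma holo_compB : zmod_morphism holo_comp.
Proof.
move=> f g; apply: holoP => b /=; rewrite /ps_add /ps_opp /= /ps_comp.
rewrite -[RHS]/((pcomp _ - pcomp _) b) /pcomp -mmapB; congr (tcoef (mmap _ _ _) _).
by apply/mpolyP => a; rewrite mcoeffB !trunc_coef; case: ifP; rewrite ?subr0.
Qed.

HB.instance Definition _ :=
  GRing.isZmodMorphism.Build (holo K n) (holo K m) holo_comp holo_compB.

Lemma holo_compM (f g : holo K n) : holo_comp (f * g) = holo_comp f * holo_comp g.
Proof.
apply: holoP => b; pose N := (mdeg b).+1.
transitivity (pcomp (trunc N f * trunc N g) b).
  by apply: (pcomp_eq (N := N)) => // a aN; rewrite trunc_mul// trunc_coef aN.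
rewrite /pcomp rmorphM/= /ps_mul; apply: eq_bigr => k kb /=.
by rewrite -!ps_compE// ltnS lem_mdeg// lem_subr.
Qed.

Lemma holo_compC c : holo_comp (holoC n c) = holoC m c.
Proof.
apply: holoP => b /=; rewrite /ps_comp /pcomp.
have -> : trunc (mdeg b).+1 (ps_const c) = mpolyC n c.
  apply/mpolyP => a; rewrite trunc_coef mcoeffC /ps_const eq_sym.
  by have [->|] := eqVneq a mnm0; rewrite ?mdeg0/= ?mulr1// mulr0 if_same.
by rewrite mmapC.
Qed.

Lemma holo_comp_mon1 i : holo_comp (holo_mon K (mnm1 i)) = U i.
Proof.
apply: holoP => b; rewrite [LHS](@ps_compE (mdeg b).+2)//.
have -> : trunc (mdeg b).+2 (ps_mon K (mnm1 i)) = mpolyX K (mnm1 i).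
  apply/mpolyP => a; rewrite trunc_coef mcoeffX /ps_mon eq_sym.
  by have [<-|] := eqVneq (mnm1 i) a; rewrite ?mdeg1// if_same.
by rewrite /pcomp mmapX mmap1U.
Qed.

Lemma holo_comp_value0 g : value0 (holo_comp g) = value0 g.
Proof.
rewrite /value0 /= /ps_comp /pcomp.
rewrite -[RHS](_ : holoC m (g mnm0) mnm0 = _); last by rewrite /= /ps_const eqxx.
rewrite -(mmapC U (@holoC K m)).
apply: (@pcomp_eq 1); first by rewrite mdeg0.
move=> a; rewrite ltnS leqn0 mdeg_eq0 => /eqP ->.
by rewrite trunc_coef !mdeg0 mcoeffC eqxx mulr1.
Qed.

(** The polynomials satisfying the chain rule form a subring containing the
    constants and the variables. *)
Lemma pcomp_der k p : holo_der k (pcomp p) =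
  \sum_i holo_der k (U i) * pcomp (mderiv i p).
Proof.
pose P p := holo_der k (pcomp p) = \sum_i holo_der k (U i) * pcomp (mderiv i p).
have PD q1 q2 : P q1 -> P q2 -> P (q1 + q2).
  rewrite /P /pcomp mmapD raddfD/= => -> ->; rewrite -big_split/=.
  by apply: eq_bigr => i _; rewrite mderivD mmapD mulrDr.
have PM q1 q2 : P q1 -> P q2 -> P (q1 * q2).
  rewrite /P /pcomp rmorphM/= holo_derM => -> ->.
  rewrite mulr_suml mulr_sumr -big_split/=.
  apply: eq_bigr => i _; rewrite mderivM mmapD !rmorphM/= mulrDr.
  by rewrite !mulrA; congr (_ + _ * _); rewrite mulrC.
have PC c : P (mpolyC n c).
  rewrite /P /pcomp mmapC holo_derC big1// => i _.
  by rewrite mderivC mmap0 mulr0.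
have PX i : P (mpolyX K (mnm1 i)).
  rewrite /P /pcomp mmapX mmap1U (bigD1 i)//= big1 ?addr0 => [|j ji].
    rewrite mderivX mnm1E eqxx scale1r.
    rewrite (_ : mnm_sub _ _ = mnm0) ?mmapX ?mmap11 ?mulr1//.
    by apply/mnmP => l; rewrite mnmBE subnn mnm0E.
  by rewrite mderivX mnm1E eq_sym (negbTE ji) scale0r mmap0 mulr0.
rewrite -/(P p) (mpolyE p); elim/big_ind: _ => [|q1 q2 |a _]; [|exact: PD|].
  by rewrite -(mpolyC0 n); apply: PC.
rewrite -mul_mpolyC; apply: (PM); first exact: PC.
rewrite mpolyXE_id; elim/big_ind: _ => [|q1 q2|i _]; [|exact: PM|].
  by rewrite -[1]/(mpolyC n 1); apply: PC.
elim: (a i) => [|d IH]; first by rewrite expr0; apply: (PC 1).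
by rewrite exprS; apply: PM.
Qed.

Lemma holo_comp_der k g : holo_der k (holo_comp g) =
  \sum_i holo_der k (U i) * holo_comp (holo_der i g).
Proof.
apply: holoP => b; rewrite tcoef_sum /= /ps_der /=; pose N := (mdeg b).+2.
rewrite (ps_compE (N := N)) ?mdegD ?mdeg1 ?addn1//.
rewrite -[LHS]/(holo_der k _ b) pcomp_der tcoef_sum.
apply: eq_bigr => i _; rewrite !tcoefM /ps_mul; apply: eq_bigr => l lb /=.
congr (_ * _); rewrite (ps_compE (N := (mdeg b).+1)) ?ltnS ?lem_mdeg ?lem_subr//.
apply: (pcomp_eq (N := (mdeg b).+1)); first by rewrite ltnS lem_mdeg ?lem_subr.
move=> a aN; rewrite mcoeff_deriv !trunc_coef mdegD mdeg1 addn1 aN /N ltnS aN.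
by rewrite /ps_der mulr_natl.
Qed.

End Composition.

(** Up to a constant the germ is 1 - v with v vanishing at the origin, and its
    inverse is the composition of the geometric series with v. *)
Lemma holo_unit (K : numFieldType) m (f : holo K m) :
  value0 f != 0 -> exists g, g * f = 1.
Proof.
move=> f0; pose c := value0 f.
pose v := 1 - holoC m c^-1 * f.
have v0 (i : 'I_1) : value0 v = 0.
  rewrite /value0 /v tcoefD tcoefN tcoefCM mulVf// /= /ps_const eqxx.
  by rewrite subrr.
have cgeo : converges (fun _ : multinom 1 => 1 : K).
  by exists 1, 1; split=> // a; rewrite normr1 expr1n mulr1.
pose geo := Holo cgeo.
pose x : holo K 1 := holo_mon K (mnm1 ord0).
have gx : geo * (1 - x) = 1.
  rewrite mulrBr mulr1 [geo * x]mulrC; apply: holoP => a.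
  rewrite tcoefD tcoefN tcoef_monM /= /ps_const lep1mP.
  have -> : (a ord0 != 0)%N = (a != mnm0).
    by rewrite -mdeg_eq0 mdegE big_ord1.
  by case: eqP; rewrite ?subr0 ?subrr.
exists (holo_comp v0 geo * holoC m c^-1).
have := congr1 (holo_comp v0) gx; rewrite holo_compM raddfB/=.
rewrite (_ : 1 = holoC 1 1)// holo_compC holo_comp_mon1 (rmorph1 (@holoC K m)) => <-.
rewrite -mulrA; congr (_ * _).
by rewrite /v opprB addrC subrK.
Qed.

(** * Coordinate frames and the Taylor expansion in given coordinates *)

(** Both sides are compared with n! times the central binomial coefficient. *)
Lemma expn_self_le n : (n ^ n <= 4 ^ n * n`!)%N.
Proof.
have -> : (4 ^ n = 2 ^ (n + n))%N by rewrite addnn -mul2n expnM.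
apply: leq_trans (_ : 'C(n + n, n) * n`! <= _)%N; last first.
  rewrite leq_mul2r; apply/orP; right.
  rewrite -[2%N]/(1 + 1)%N expnDn.
  have nn : (n < (n + n).+1)%N by rewrite ltnS leq_addl.
  rewrite (bigD1 (Ordinal nn))//= !exp1n !muln1; exact: leq_addr.
rewrite bin_ffact.
suff H k : (k <= n)%N -> (n ^ k <= (n + n) ^_ k)%N by apply: H.
elim: k => [//|k IH] kn.
rewrite expnSr ffactnSr leq_mul ?IH//; [exact: ltnW|].
by rewrite -addnBA ?leq_addr// ltnW.
Qed.

Section Words.
Variable m : nat.
Implicit Types a : multinom m.

Lemma mnm_neq0 a : a != mnm0 -> exists k, lem (mnm1 k) a.
Proof.
move=> a0; suff [k ak] : exists k, a k != 0%N by exists k; rewrite lep1mP.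
apply/existsP; apply: contraNT a0; rewrite negb_exists => /forallP ak.
by apply/eqP/mnmP => k; rewrite mnm0E; apply/eqP; have := ak k; rewrite negbK.
Qed.

Lemma holo_der_eq0 (K : numFieldType) k (f : holo K m) a : lem (mnm1 k) a ->
  holo_der k f (mnm_sub a (mnm1 k)) = 0 -> f a = 0.
Proof.
move=> ka; rewrite /= /ps_der submK// => /eqP; rewrite mulf_eq0 pnatr_eq0/=.
by move=> /eqP.
Qed.

Definition mfact a := (\prod_(i < m) (a i)`!)%N.

Lemma mfact_gt0 a : (0 < mfact a)%N.
Proof. by rewrite prodn_gt0// => i; apply: fact_gt0. Qed.

Lemma mfactD1 a i : mfact (mnm_add a (mnm1 i)) = ((a i).+1 * mfact a)%N.
Proof.
rewrite /mfact (bigD1 i)//= [in RHS](bigD1 i)//= mulnA.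
rewrite mnmDE mnm1E eqxx addn1 factS; congr (_ * _)%N.
by apply: eq_bigr => j ji; rewrite mnmDE mnm1E eq_sym (negbTE ji) addn0.
Qed.

(** The quotient |a|!/a! counts the words in m letters whose content is a. *)
Lemma fact_mdeg_le a : ((mdeg a)`! <= m ^ mdeg a * mfact a)%N.
Proof.
move: {2}(mdeg a) (erefl (mdeg a)) => n; elim: n a => [|n IH] a an.
  by rewrite an expn0 mul1n mfact_gt0.
rewrite an factS -{1}an mdegE big_distrl/=.
apply: leq_trans (_ : \sum_(i < m) m ^ n * mfact a <= _)%N; last first.
  by rewrite sum_nat_const card_ord mulnA expnS.
apply: leq_sum => i _; have [->//|ai] := eqVneq (a i) 0%N.
have ia : lem (mnm1 i) a by rewrite lep1mP.
have e : a = mnm_add (mnm_sub a (mnm1 i)) (mnm1 i) by rewrite submK.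
have d : mdeg (mnm_sub a (mnm1 i)) = n.
  by have := mdeg_subK ia; rewrite mdeg1 addn1 an => -[].
rewrite {2}e mfactD1 mulnCA mnmBE mnm1E eqxx subn1 prednK ?lt0n//.
by rewrite leq_mul2l -{1 2}d IH ?orbT.
Qed.

Lemma count_m2s a i : count_mem i (m2s a) = a i.
Proof. by rewrite -{2}(s2mK a) mnmE. Qed.

Lemma m2sD1 a i : perm_eq (rcons (m2s a) i) (m2s (mnm_add a (mnm1 i))).
Proof.
apply/allP => j _ /=; rewrite -cats1 count_cat !count_m2s mnmDE mnm1E /=.
by rewrite addn0.
Qed.

End Words.

(** The derivations of another frame, of which P is the matrix in the frame d. *)
Definition frame_der (A : pzRingType) m (d : 'I_m -> A -> A)
    (P : 'I_m -> 'I_m -> A) (l : 'I_m) (x : A) : A := \sum_k P l k * d k x.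

Section Frame.
Variables (K : numFieldType) (m : nat) (U : 'I_m -> holo K m).
Variables (P : 'I_m -> 'I_m -> holo K m).
Hypothesis U0 : forall i, value0 (U i) = 0.
Hypothesis PU : forall l j, \sum_k P l k * holo_der k (U j) = (l == j)%:R.
Hypothesis UP : forall k j, \sum_l holo_der k (U l) * P l j = (k == j)%:R.
Implicit Types (f g : holo K m) (a b : multinom m).

Local Notation fder := (frame_der (@holo_der K m) P).

Lemma fder_zmod l : zmod_morphism (fder l).
Proof.
move=> f g; rewrite /frame_der -sumrB; apply: eq_bigr => k _.
by rewrite raddfB/= mulrBr.
Qed.

HB.instance Definition _ l :=
  GRing.isZmodMorphism.Build (holo K m) (holo K m) (fder l) (fder_zmod l).

Lemma fderM l f g : fder l (f * g) = fder l f * g + f * fder l g.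
Proof.
rewrite /frame_der mulr_suml mulr_sumr -big_split/=; apply: eq_bigr => k _.
by rewrite holo_derM mulrDr !mulrA; congr (_ + _ * _); rewrite mulrC.
Qed.

Lemma fderC l c : fder l (holoC m c) = 0.
Proof. by rewrite /frame_der big1// => k _; rewrite holo_derC mulr0. Qed.

Lemma fderU l j : fder l (U j) = (l == j)%:R. Proof. exact: PU. Qed.

(** The chain rule in the coordinates U. *)
Lemma holo_der_fder k f : holo_der k f = \sum_l holo_der k (U l) * fder l f.
Proof.
transitivity (\sum_j (k == j)%:R * holo_der j f).
  rewrite (bigD1 k)//= eqxx mul1r big1 ?addr0// => j /negbTE jk.
  by rewrite eq_sym jk mul0r.
under eq_bigr => j _ do rewrite -UP mulr_suml.
rewrite exchange_big/=; apply: eq_bigr => l _.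
by rewrite mulr_sumr; apply: eq_bigr => j _; rewrite mulrA.
Qed.

Lemma fder_nat l n : fder l n%:R = 0.
Proof. by rewrite -(rmorph_nat (@holoC K m)) fderC. Qed.

(** The bracket of two frame fields is a vector field killing every U l, hence
    it is zero because the U l are coordinates. *)
Lemma fderP i j k : fder i (P j k) = fder j (P i k).
Proof.
pose c k := fder i (P j k) - fder j (P i k).
have fder2 i' j' f : fder i' (fder j' f) = \sum_k fder i' (P j' k) * holo_der k f
    + \sum_k \sum_k' P j' k * P i' k' * holo_der k' (holo_der k f).
  rewrite {2}/frame_der raddf_sum/= -big_split/=; apply: eq_bigr => k' _.
  rewrite fderM; congr (_ + _); rewrite /frame_der mulr_sumr.
  by apply: eq_bigr => k'' _; rewrite mulrA.
have cU l : \sum_k c k * holo_der k (U l) = 0.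
  have : fder i (fder j (U l)) - fder j (fder i (U l)) = 0.
    by rewrite !fderU !fder_nat subrr.
  rewrite !fder2 opprD addrACA -sumrB => e.
  under eq_bigr do rewrite mulrBl.
  apply: etrans e; rewrite -[LHS]addr0; congr (_ + _).
  apply/esym/eqP; rewrite subr_eq0; apply/eqP.
  rewrite exchange_big/=; apply: eq_bigr => k1 _; apply: eq_bigr => k2 _.
  by rewrite holo_derAC [P j _ * _]mulrC.
apply/eqP; rewrite -subr_eq0; apply/eqP.
transitivity (\sum_l (\sum_k' c k' * holo_der k' (U l)) * P l k); last first.
  by rewrite big1// => l _; rewrite cU mul0r.
under eq_bigr do rewrite mulr_suml.
rewrite exchange_big/=.
under eq_bigr => k' _ do under eq_bigr => l _ do rewrite -mulrA.
under eq_bigr => k' _ do rewrite -mulr_sumr UP.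
rewrite (bigD1 k)//= eqxx mulr1 big1 ?addr0// => k' /negbTE ->.
by rewrite mulr0.
Qed.

Lemma fderAC i j f : fder i (fder j f) = fder j (fder i f).
Proof.
rewrite {2 4}/frame_der !raddf_sum/=.
under eq_bigr do rewrite fderM fderP.
under [RHS]eq_bigr do rewrite fderM.
rewrite !big_split/=; congr (_ + _); rewrite {1 2}/frame_der.
under eq_bigr do rewrite mulr_sumr.
under [RHS]eq_bigr do rewrite mulr_sumr.
rewrite exchange_big/=; apply: eq_bigr => k1 _; apply: eq_bigr => k2 _.
by rewrite holo_derAC mulrCA.
Qed.

(** Iterated derivatives are indexed by words rather than by exponents, for the
    sake of induction; the order of the letters is irrelevant. *)
Definition fderw (w : seq 'I_m) f := foldr fder f w.

Lemma fderw_perm w w' f : perm_eq w w' -> fderw w f = fderw w' f.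
Proof.
move=> ww'; apply: (catCA_perm_ind (P := fun s => fderw w f = fderw s f) _ ww').
  move=> s1 s2 s3 ->; rewrite /fderw !foldr_cat.
  elim: s1 => [//|i s1 IH] /=; rewrite IH.
  by elim: s2 {IH} => [//|j s2 IH] /=; rewrite -IH fderAC.
by [].
Qed.

(** The Taylor expansion of f in the coordinates U. *)
Definition ps_taylor f a : K := value0 (fderw (m2s a) f) / (mfact a)%:R.

Lemma ps_taylor_der i f a : ps_der i (ps_taylor f) a = ps_taylor (fder i f) a.
Proof.
rewrite /ps_der /ps_taylor mfactD1 -(fderw_perm _ (m2sD1 a i)).
rewrite /fderw foldr_rcons natrM invfM mulrCA; congr (_ * _).
by rewrite mulrA mulfV ?mul1r// pnatr_eq0.
Qed.

(** Each derivation costs the same loss d of radius and the same factor in the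
    norm, by Cauchy's estimate. *)
Lemma l1_le_fderw s C M d f w : 0 < d -> (size w)%:R * d < s ->
  (forall l k, l1_le s C (P l k)) -> l1_le s M f ->
  l1_le (s - (size w)%:R * d) (M * (m%:R * C / d) ^+ size w) (fderw w f).
Proof.
move=> d0; elim: w => [|l w IH] /= ws PC fM.
  by rewrite mul0r subr0 expr0 mulr1.
have ws' : (size w)%:R * d < s.
  by apply: lt_trans ws; rewrite ltr_pM2r// ltr_nat.
have /IH{}IH := ws'; set g := fderw w f; set N := M * _ in IH *.
have {}IH := IH PC fM.
set s1 := s - _ in IH; set s2 := s - _.
have s21 : s1 - s2 = d by rewrite /s1 /s2 -natr1; ring.
have s20 : 0 < s2 by rewrite subr_gt0.
have s12 : s2 < s1 by rewrite -subr_gt0 s21.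
have s2s : s2 <= s by rewrite gerBl mulr_ge0// ltW.
have -> : M * (m%:R * C / d) ^+ (size w).+1 = \sum_(k < m) C * (N / d).
  by rewrite sumr_const card_ord /N exprS -mulr_natl; ring.
rewrite /frame_der; apply: l1_le_sum => [|k]; first exact: ltW.
apply: l1_le_mul; first exact: ltW.
  by apply: l1_le_le s2s (lexx _) (PC l k); apply: ltW.
by rewrite -s21; apply: l1_le_der.
Qed.

(** Applying n = |a| derivations with losses of radius s / 2n gives a bound by
    M (c n) ^ n, where n ^ n is at most (4 m) ^ n a!. *)
Lemma converges_taylor f : converges (ps_taylor f).
Proof.
have [s1 [C [s10 C0 PC]]] := common_l1_le (fun p : 'I_m * 'I_m => P p.1 p.2).
have [s2 [M [s20 M0 fM]]] := common_l1_le (fun _ : 'I_1 => f).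
have [s [s0 ss1 ss2]] : exists s, [/\ 0 < s, s <= s1 & s <= s2].
  have [h|h] := real_leP (gtr0_real s10) (gtr0_real s20).
    by exists s1; rewrite h lexx s10.
  by exists s2; rewrite (ltW h) lexx s20.
have {}PC l k : l1_le s C (P l k).
  exact: l1_le_le (ltW s0) ss1 (lexx _) (PC (l, k)).
have {}fM : l1_le s M f by apply: l1_le_le (ltW s0) ss2 (lexx _) (fM ord0).
pose B := m%:R * (4 * (m%:R * C / (s / 2))) + 1.
have B0 : 0 < B by rewrite ltr_wpDl// !mulr_ge0 ?invr_ge0 ?divr_ge0 ?ler0n ?(ltW s0).
exists B^-1, M; split=> [|a]; first by rewrite invr_gt0.
rewrite exprVn ler_pdivrMr ?exprn_gt0//.
rewrite /ps_taylor normrM normfV normr_nat ler_pdivrMr ?ltr0n ?mfact_gt0//.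
set n := mdeg a; have [n0|n0] := posnP n.
  have -> : m2s a = [::] by apply/eqP; rewrite -size_eq0 size_m2s -/n n0.
  have := l1_le_coef mnm0 (ltW s0) fM; rewrite mdeg0 mulr1 n0 expr0 mulr1.
  by move/le_trans; apply; rewrite ler_peMr// ler1n mfact_gt0.
pose d := s / (2 * n%:R).
have d0 : 0 < d by rewrite divr_gt0// mulr_gt0// ltr0n.
have nd : n%:R * d = s / 2.
  by rewrite /d; field; rewrite pnatr_eq0 -lt0n n0.
have szw : size (m2s a) = n by rewrite size_m2s.
have := @l1_le_fderw s C M d f (m2s a) d0; rewrite szw nd.
have s2s : s / 2 < s by rewrite ltr_pdivrMr// ltr_pMr// ltr1n.
move=> /(_ s2s PC fM) /(l1_le_coef mnm0); rewrite subr_ge0 ltW// mdeg0 mulr1.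
move=> /(_ isT) /le_trans; apply.
rewrite -[leRHS]mulrA ler_wpM2l//.
have -> : m%:R * C / d = n%:R * (m%:R * C / (s / 2)).
  rewrite -nd; field.
  by rewrite pnatr_eq0 -lt0n n0 gt_eqF.
set c := m%:R * C / (s / 2).
have c0 : 0 <= c by rewrite !mulr_ge0 ?invr_ge0 ?divr_ge0 ?ler0n ?(ltW s0).
apply: le_trans (_ : (m%:R * (4 * c)) ^+ n * (mfact a)%:R <= _); last first.
  apply: ler_wpM2r => //; rewrite lerXn2r ?nnegrE ?(ltW B0)//; last first.
    by rewrite lerDl.
  by rewrite mulr_ge0// mulr_ge0.
clearbody c; rewrite !exprMn.
rewrite [leRHS](_ : _ = 4 ^+ n * (m%:R ^+ n * (mfact a)%:R) * c ^+ n); last first.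
  by move: (m%:R ^+ n) (4 ^+ n) (c ^+ n) => x y z; ring.
apply: ler_wpM2r; first exact: exprn_ge0.
rewrite -!natrX -!natrM ler_nat.
apply: leq_trans (expn_self_le n) _.
rewrite leq_mul2l; apply/orP; right; exact: fact_mdeg_le.
Qed.

Definition taylor f : holo K m := Holo (converges_taylor f).

Lemma taylor_der i f : taylor (fder i f) = holo_der i (taylor f).
Proof. by apply: holoP => a; rewrite /= ps_taylor_der. Qed.

Lemma fder_comp l g : fder l (holo_comp U0 g) = holo_comp U0 (holo_der l g).
Proof.
rewrite /frame_der; under eq_bigr do rewrite holo_comp_der mulr_sumr.
rewrite exchange_big/=.
under eq_bigr => i _ do under eq_bigr => k _ do rewrite mulrA.
under eq_bigr => i _ do rewrite -mulr_suml PU.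
rewrite (bigD1 l)//= eqxx mul1r big1 ?addr0// => i /negbTE il.
by rewrite eq_sym il mul0r.
Qed.

(** The frame spans all vector fields, so that the vanishing of all iterated
    derivatives along it passes to the partial derivatives, by induction on the
    order. *)
Lemma fderw_eq0 f : (forall w, value0 (fderw w f) = 0) -> f = 0.
Proof.
move=> f0; apply: holoP => a; rewrite tcoef0.
suff H : forall n f, (forall w, value0 (fderw w f) = 0) -> vanish n f.
  exact: (H (mdeg a).+1 f).
elim=> [//|n IH] {}f {}f0 {}a an.
have [->|/mnm_neq0[k ka]] := eqVneq a mnm0; first exact: (f0 [::]).
apply: (holo_der_eq0 ka); rewrite holo_der_fder tcoef_sum big1// => l _.
have H : vanish n (fder l f).
  by apply: IH => w; have := f0 (rcons w l); rewrite /fderw foldr_rcons.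
apply: (vanishM (d := 0) _ H) => //.
by have := mdeg_subK ka; rewrite mdeg1 add0n; lia.
Qed.

(** Both sides have the same iterated derivatives at the origin along the
    frame. Together with [holo_comp_inj], this is the inverse function theorem:
    composition with the coordinates U is bijective. *)
Lemma taylorK f : holo_comp U0 (taylor f) = f.
Proof.
apply/eqP; rewrite -subr_eq0; apply/eqP/fderw_eq0 => w.
have wB h1 h2 : fderw w (h1 - h2) = fderw w h1 - fderw w h2.
  by elim: w => [//|i w IH] /=; rewrite IH raddfB.
rewrite wB /value0 tcoefD tcoefN -!/(value0 _).
have -> : fderw w (holo_comp U0 (taylor f)) = holo_comp U0 (taylor (fderw w f)).
  by elim: w {wB} => [//|i w IH] /=; rewrite IH taylor_der fder_comp.
rewrite holo_comp_value0 /value0 /= /ps_taylor.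
have -> : m2s (@mnm0 m) = [::].
  by apply/eqP; rewrite -size_eq0 size_m2s mdeg0.
have -> : mfact (@mnm0 m) = 1%N by rewrite /mfact big1// => i _; rewrite mnm0E.
by rewrite divr1 subrr.
Qed.

Lemma holo_comp_inj : injective (holo_comp U0).
Proof.
suff H g : holo_comp U0 g = 0 -> g = 0.
  move=> f1 f2 /eqP; rewrite -subr_eq0 -raddfB => /eqP /H /eqP.
  by rewrite subr_eq0 => /eqP.
move=> g0; apply: holoP => a; rewrite tcoef0.
suff {a} : forall n g, holo_comp U0 g = 0 -> vanish n g.
  by move=> /(_ (mdeg a).+1 g g0 a); apply.
elim=> [//|n IH] {}g {}g0 a an.
have [->|/mnm_neq0[k ka]] := eqVneq a mnm0.
  by have := holo_comp_value0 U0 g; rewrite g0 /value0 tcoef0 => <-.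
apply: (@holo_der_eq0 _ _ k g a ka); apply: (IH _ _ (mnm_sub a (mnm1 k))).
  by rewrite -fder_comp g0 raddf0.
by have := mdeg_subK ka; rewrite mdeg1; lia.
Qed.

End Frame.

(** * Small divisors: the linear model *)

(** The Diophantine condition with a natural exponent, in any field where it
    makes sense. *)
Definition dioph_pow (K : numFieldType) (lam : K) :=
  exists (c : K) (d : nat), 0 < c /\ forall x y : int, (x, y) != (0, 0) ->
    c <= `|x%:~R + lam * y%:~R| * (`|x| + `|y|)%:~R ^+ d.

Section Model.
Variables (K : numFieldType) (m : nat) (i j : 'I_m) (lam : K) (p : nat).
Hypothesis ij : i != j.
Hypothesis lam_dioph : dioph_pow lam.
Implicit Types (a b : multinom m) (f : holo K m).

(** With x, y the variables number i, j, this is the operator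
    x d_x + lam y d_y conjugated by (x y)^p: solving for euler amounts to solving
    for that field among functions with a pole of order p along x y = 0. Its
    eigenvectors are the monomials, with eigenvalues [weight]. *)
Definition euler f : holo K m :=
  holo_mon K (mnm1 i) * holo_der i f
  + holoC m lam * (holo_mon K (mnm1 j) * holo_der j f)
  - holoC m (p%:R * (1 + lam)) * f.

(** The exponent of (x y)^p. *)
Definition reson : multinom m := mnm_add (mnm_muln (mnm1 i) p) (mnm_muln (mnm1 j) p).

Definition weight a : K :=
  ((a i)%:Z - p%:Z)%:~R + lam * ((a j)%:Z - p%:Z)%:~R.

Lemma tcoef_mon1_der l f a :
  (holo_mon K (mnm1 l) * holo_der l f) a = (a l)%:R * f a.
Proof.
rewrite tcoef_monM; case: ifPn => la; last first.
  by move: la; rewrite lep1mP negbK => /eqP ->; rewrite mul0r.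
rewrite /= /ps_der submK// mnmBE mnm1E eqxx subn1 prednK// lt0n.
by rewrite -lep1mP.
Qed.

Lemma tcoef_euler f a : (euler f) a = weight a * f a.
Proof.
rewrite /euler tcoefD tcoefN tcoefD !tcoefCM !tcoef_mon1_der /weight.
by rewrite !rmorphB/= !pmulrn; ring.
Qed.

Lemma weight_eq0 a : weight a = 0 -> a i = p /\ a j = p.
Proof.
have [c [d [c0 H]]] := lam_dioph; rewrite /weight => w0.
have [[/eqP]|/H] := eqVneq ((a i)%:Z - p%:Z, (a j)%:Z - p%:Z) (0, 0).
  by rewrite !subr_eq0 => /eqP [->] /eqP; rewrite subr_eq0 => /eqP [->].
by rewrite w0 normr0 mul0r => /(lt_le_trans c0); rewrite ltxx.
Qed.

Lemma weight_reson : weight reson = 0.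
Proof.
rewrite /weight !mnmDE !mulmnE !mnm1E !eqxx [j == i]eq_sym (negbTE ij).
by rewrite !mul1n !mul0n addn0 add0n !subrr mulr0 addr0.
Qed.

Lemma weightD1 l a : l != i -> l != j -> weight (mnm_add a (mnm1 l)) = weight a.
Proof.
by move=> /negbTE li /negbTE lj; rewrite /weight !mnmDE !mnm1E li lj !addn0.
Qed.

Lemma reson_or a : weight a = 0 -> a != reson ->
  exists k, [/\ k != i, k != j & a k != 0%N].
Proof.
move=> /weight_eq0[ai aj] ar.
have /existsP[k /and3P[ki kj ak]] : [exists k, [&& k != i, k != j & a k != 0%N]].
  apply: contraNT ar; rewrite negb_exists => /forallP ak; apply/eqP/mnmP => k.
  rewrite mnmDE !mulmnE !mnm1E; have [<-|ik] := eqVneq i k.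
    by rewrite [j == i]eq_sym (negbTE ij) mul1n mul0n addn0.
  have [<-|jk] := eqVneq j k; first by rewrite mul0n mul1n.
  have := ak k; rewrite eq_sym ik eq_sym jk /= negbK => /eqP ->.
  by rewrite !mul0n.
by exists k.
Qed.

(** The small divisors are at least an inverse power of |a|, and therefore at
    least an inverse exponential: dividing by them preserves convergence. *)
Lemma weight_ge : exists B : K, 0 < B /\ exists d : nat, forall a,
  weight a != 0 -> `|weight a|^-1 <= B * (2 ^+ d) ^+ mdeg a.
Proof.
have [c [d [c0 H]]] := lam_dioph.
exists ((2 ^+ (p + p)) ^+ d / c); split; first by rewrite divr_gt0 ?exprn_gt0.
exists d => a w0; have w0' : 0 < `|weight a| by rewrite normr_gt0.
have xy0 : ((a i)%:Z - p%:Z, (a j)%:Z - p%:Z) != (0, 0).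
  apply: contraNneq w0 => -[]; rewrite /weight => -> ->.
  by rewrite mulr0 addr0.
have := H _ _ xy0; rewrite -/(weight a) => cw.
rewrite -div1r ler_pdivrMr// -(ler_pM2l c0) mulr1; apply: le_trans cw _.
have -> : forall x y z : K, c * (x / c * y * z) = z * (x * y).
  by move=> x y z; field; rewrite gt_eqF.
apply: ler_wpM2l => //; rewrite [X in _ <= _ * X]exprAC -exprMn -exprD.
have h0 : (0 : int) <= `|(a i)%:Z - p%:Z| + `|(a j)%:Z - p%:Z|.
  by rewrite addr_ge0.
rewrite lerXn2r ?nnegrE ?exprn_ge0 ?ler0z//.
have aij : (a i + a j <= mdeg a)%N.
  by rewrite mdegE (bigD1 i)//= (bigD1 j) 1?eq_sym//= addnA leq_addr.
rewrite -natrX -[leRHS]mulrz_nat ler_int.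
have := ltn_expl (p + p + mdeg a) (isT : (1 < 2)%N).
by move: (2 ^ _)%N aij => N; lia.
Qed.

Variables (A : holo K m) (C : 'I_m -> holo K m).
Hypothesis EC : forall l, l != i -> l != j -> euler (C l) = holo_der l A.
Hypothesis CC : forall k l, k != i -> k != j -> l != i -> l != j ->
  holo_der k (C l) = holo_der l (C k).

Definition ps_sol a : K :=
  if weight a != 0 then A a / weight a else
  if [pick k | [&& k != i, k != j & a k != 0%N]] is Some k
  then C k (mnm_sub a (mnm1 k)) / (a k)%:R else 0.

(** At a resonance the division is by an exponent, hence harmless. *)
Lemma converges_sol : converges ps_sol.
Proof.
have [s [M [s0 M0 sM]]] :=
  common_l1_le (fun o : option 'I_m => if o is Some k then C k else A).
have [B [B0 [d BW]]] := weight_ge.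
have e0 : 0 < (2 ^+ d : K) by rewrite exprn_gt0.
have e1 : 1 <= (2 ^+ d : K) by rewrite exprn_ege1// ler1n.
have es : s / 2 ^+ d <= s by rewrite ler_pdivrMr// ler_peMr// ltW.
exists (s / 2 ^+ d), (M * B + M * s); split=> [|a]; first by rewrite divr_gt0.
have sd0 : 0 <= s / 2 ^+ d by rewrite divr_ge0 ?(ltW s0) ?(ltW e0).
rewrite /ps_sol; case: ifPn => [w0|_].
  apply: (@le_trans _ _ (M * B)); last by rewrite lerDl mulr_ge0// ltW.
  rewrite normrM normfV expr_div_n.
  have -> : `|A a| / `|weight a| * (s ^+ mdeg a / (2 ^+ d) ^+ mdeg a) =
    (`|A a| * s ^+ mdeg a) * (`|weight a|^-1 / (2 ^+ d) ^+ mdeg a) by rewrite mulrACA.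
  apply: ler_pM; rewrite ?mulr_ge0 ?divr_ge0 ?invr_ge0 ?exprn_ge0 ?(ltW s0)//.
    exact: (l1_le_coef a (ltW s0) (sM None)).
  by rewrite ler_pdivrMr ?exprn_gt0// BW.
apply: (@le_trans _ _ (M * s)); last by rewrite lerDr mulr_ge0// ltW.
case: pickP => [k /and3P[_ _ ak]|_]; last first.
  by rewrite normr0 mul0r mulr_ge0// ltW.
have ka : lem (mnm1 k) a by rewrite lep1mP.
have := mdeg_subK ka; rewrite mdeg1 => <-.
rewrite exprD expr1 [leLHS]mulrA; apply: ler_pM => //.
  by rewrite mulr_ge0// exprn_ge0.
have := l1_le_coef (mnm_sub a (mnm1 k)) (ltW s0) (sM (Some k)).
apply: le_trans; apply: ler_pM => //; rewrite ?exprn_ge0//.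
  rewrite normrM normfV normr_nat ler_pdivrMr ?ltr0n ?lt0n//.
  by rewrite ler_peMr// ler1n lt0n.
by rewrite lerXn2r// nnegrE ltW.
Qed.

(** Off the resonances the first equation determines the coefficients of h by
    division, and the compatibility condition yields the second equation. At the
    resonances the first equation says nothing on h; there the condition forces
    the coefficients of A to vanish, except that of (x y)^p, which is the
    obstruction kappa, and the second equation integrates the closed family C. *)
Lemma model_solve : exists (h : holo K m) (kappa : K),
  euler h = A - holoC m kappa * holo_mon K reson /\
  forall l, l != i -> l != j -> holo_der l h = C l.
Proof.
exists (Holo converges_sol), (A reson); split=> [|l li lj]; apply: holoP => a.
  rewrite tcoef_euler tcoefD tcoefN tcoefCM /= /ps_mon /ps_sol.
  have [->|ar] := eqVneq a reson.
    by rewrite weight_reson mul0r mulr1 subrr.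
  rewrite mulr0 subr0; case: ifPn => [w0|]; first by rewrite mulrC divfK.
  rewrite negbK => /eqP w0; rewrite w0 mul0r.
  have [k [ki kj ak]] := reson_or w0 ar.
  have ka : lem (mnm1 k) a by rewrite lep1mP.
  apply/esym/(holo_der_eq0 ka); rewrite -EC// tcoef_euler -(weightD1 _ ki kj).
  by rewrite submK// w0 mul0r.
rewrite /= /ps_der /ps_sol weightD1//.
case: ifPn => [w0|]; first rewrite mulrA.
  rewrite -[_ * A _]/(holo_der l A a) -EC// tcoef_euler.
  by rewrite mulrC mulKf.
rewrite negbK => /eqP w0; case: pickP => [k /and3P[ki kj ak]|/(_ l)]; last first.
  by rewrite li lj mnmDE mnm1E eqxx addn1.
have ak0 : (mnm_add a (mnm1 l) k)%:R != 0 :> K by rewrite pnatr_eq0.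
rewrite mulrA; apply: (canLR (mulfK ak0)).
have [<-|kl] := eqVneq k l.
  by rewrite addmK mnmDE mnm1E eqxx addn1 mulrC.
have lk : (l == k) = false by rewrite eq_sym (negbTE kl).
have ka : lem (mnm1 k) a by move: ak; rewrite lep1mP mnmDE mnm1E lk addn0.
have := congr1 (fun f : holo K m => f (mnm_sub a (mnm1 k))) (CC li lj ki kj).
rewrite /= /ps_der submK// !mnmBE !mnm1E eqxx (negbTE kl) subn0 subn1.
rewrite prednK ?lt0n -?lep1mP//.
rewrite mnmDE mnm1E lk addn0 [in X in _ = X -> _]mulrC => <-.
congr (_ * C k _); apply/mnmP => x; rewrite !(mnmDE, mnmBE) -addnBAC//.
by move/mnm_lepP: ka.
Qed.

End Model.

(** * Relatively closed forms in a frame *)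

Definition frame_coef (A : pzRingType) m (P : 'I_m -> 'I_m -> A) (l : 'I_m)
    (w : 'rV[A]_m) : A :=
  \sum_k P l k * w 0 k.

Definition log_form (A : unitRingType) m (d : 'I_m -> A -> A) (F G lam : A)
    : 'rV[A]_m :=
  \row_k (d k G / G - lam * (d k F / F)).

Section RelativeForms.
Variables (M : fieldType) (m : nat) (d : 'I_m -> M -> M).
Hypothesis dB : forall k x y, d k (x - y) = d k x - d k y.
Hypothesis dM : forall k x y, d k (x * y) = d k x * y + x * d k y.
Variables (P Q : 'I_m -> 'I_m -> M).
Hypothesis QP : forall k j, \sum_l Q k l * P l j = (k == j)%:R.
Local Notation D := (frame_der d P).
Hypothesis DP : forall i j k, D i (P j k) = D j (P i k).
Variables (i j : 'I_m) (F G lam : M).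
Hypothesis ij : i != j.
Hypothesis F0 : F != 0.
Hypothesis G0 : G != 0.
Hypothesis DF : forall l, D l F = (l == i)%:R.
Hypothesis DG : forall l, D l G = (l == j)%:R.
Hypothesis dlam : forall k, d k lam = 0.
Variable xi : 'rV[M]_m.

Local Notation omega := (log_form d F G lam).
Hypothesis rel_closed : forall a b c, wedge12 omega (diff1 d xi) a b c = 0.

Local Notation ev := (frame_coef P).

Let DB l x y : D l (x - y) = D l x - D l y.
Proof. by rewrite /frame_der -sumrB; apply: eq_bigr => k _; rewrite dB mulrBr. Qed.

Let D0 l : D l 0 = 0. Proof. by rewrite -[0 in LHS](subrr 0) DB subrr. Qed.

Let DD l x y : D l (x + y) = D l x + D l y.
Proof. by rewrite -[y in LHS]opprK -[- y]sub0r !DB D0 sub0r opprK. Qed.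

Let DM l x y : D l (x * y) = D l x * y + x * D l y.
Proof.
rewrite /frame_der mulr_suml mulr_sumr -big_split/=; apply: eq_bigr => k _.
by rewrite dM mulrDr !mulrA; congr (_ + _ * _); rewrite mulrC.
Qed.

Let Dsum l I (r : seq I) (f : I -> M) :
  D l (\sum_(x <- r) f x) = \sum_(x <- r) D l (f x).
Proof. by apply: (big_morph (D l)) => [x y|]; [apply: DD|apply: D0]. Qed.

Let Dlam l : D l lam = 0.
Proof. by rewrite /frame_der big1// => k _; rewrite dlam mulr0. Qed.

Let ev_omega l : ev l omega = (l == j)%:R / G - lam * ((l == i)%:R / F).
Proof.
rewrite -DF -DG /frame_coef /frame_der !mulr_suml mulr_sumr -sumrB.
by apply: eq_bigr => k _; rewrite mxE; ring.
Qed.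

(** Being relatively closed, d xi is a multiple tau /\ omega of omega; tau is
    the contraction of d xi with a field on which omega is 1. *)
Let tau : 'rV[M]_m := \row_a \sum_c diff1 d xi a c * (G * P j c).

Let diff1_tau a b : diff1 d xi a b = omega 0 b * tau 0 a - omega 0 a * tau 0 b.
Proof.
have oZ : \sum_c omega 0 c * (G * P j c) = 1.
  transitivity (G * ev j omega).
    by rewrite /frame_coef mulr_sumr; apply: eq_bigr => c _; ring.
  by rewrite ev_omega eqxx [j == i]eq_sym (negbTE ij) /=; field; rewrite ?F0 ?G0.
apply/eqP; rewrite -subr_eq0; apply/eqP.
transitivity (\sum_c wedge12 omega (diff1 d xi) a b c * (G * P j c)); last first.
  by rewrite big1// => c _; rewrite rel_closed mul0r.
transitivity (\sum_c (omega 0 a * (diff1 d xi b c * (G * P j c))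
    - omega 0 b * (diff1 d xi a c * (G * P j c))
    + omega 0 c * (G * P j c) * diff1 d xi a b)).
  rewrite big_split sumrB/= -!mulr_sumr -mulr_suml oZ.
  by rewrite [tau 0 a]mxE [tau 0 b]mxE; ring.
by apply: eq_bigr => c _; rewrite /wedge12; ring.
Qed.

(** d xi evaluated on two commuting fields. *)
Let bracket k l : D k (ev l xi) - D l (ev k xi) =
  ev k tau * ev l omega - ev k omega * ev l tau.
Proof.
have E k' l' : D k' (ev l' xi) = \sum_b D k' (P l' b) * xi 0 b
    + \sum_a \sum_b P k' a * P l' b * d a (xi 0 b).
  rewrite Dsum; under eq_bigr do rewrite DM.
  rewrite big_split/=; congr (_ + _); rewrite exchange_big/=.
  apply: eq_bigr => b _; rewrite /frame_der mulr_sumr; apply: eq_bigr => a _.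
  by rewrite mulrA [P l' b * _]mulrC.
rewrite !E.
have -> : \sum_b D k (P l b) * xi 0 b = \sum_b D l (P k b) * xi 0 b.
  by apply: eq_bigr => b _; rewrite DP.
rewrite opprD addrACA subrr add0r [X in _ - X]exchange_big/=.
rewrite /frame_coef !big_distrlr/= -!sumrB.
apply: eq_bigr => a _; rewrite -!sumrB; apply: eq_bigr => b _.
transitivity (P k a * P l b * diff1 d xi a b); first by rewrite [diff1 _ _ _ _]mxE; ring.
by rewrite diff1_tau; ring.
Qed.

(** The frame fields other than those of F and G are tangent to omega = 0. *)
Lemma frame_closed k l : k != i -> k != j -> l != i -> l != j ->
  D k (ev l xi) = D l (ev k xi).
Proof.
move=> /negbTE ki /negbTE kj /negbTE li /negbTE lj.
apply/eqP; rewrite -subr_eq0 bracket !ev_omega ki kj li lj.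
by rewrite !mul0r !mulr0 subrr !mul0r mulr0 subrr.
Qed.

(** So is F D_i + lam G D_j, whose values on log F and log G are 1 and lam. *)
Lemma frame_tangent l : l != i -> l != j ->
  F * D i (ev l xi) + lam * (G * D j (ev l xi)) =
  D l (F * ev i xi + lam * (G * ev j xi)).
Proof.
move=> /negbTE li /negbTE lj.
rewrite DD !DM DF DG Dlam li lj !mul0r !add0r.
apply/eqP; rewrite -subr_eq0.
have -> : forall x y z t : M, F * x + lam * (G * y) - (F * z + lam * (G * t)) =
  F * (x - z) + lam * (G * (y - t)) by move=> *; ring.
rewrite !bracket !ev_omega li lj !eqxx (negbTE ij) [j == i]eq_sym (negbTE ij).
apply/eqP; rewrite /=; field.
by rewrite F0 G0.
Qed.

(** The two equations say that xi - kappa dF/F - d h vanishes on the fields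
    tangent to omega = 0, so this form is a multiple of omega; the factor is its
    value on G D_j, a field on which omega is 1. *)
Lemma frame_decomp h kappa :
  F * D i h + lam * (G * D j h) = F * ev i xi + lam * (G * ev j xi) - kappa ->
  (forall l, l != i -> l != j -> D l h = ev l xi) ->
  forall k, xi 0 k = G * (ev j xi - D j h) * omega 0 k
     + kappa * (d k F / F) + d k h.
Proof.
move=> Xh Dh k; set a := G * _.
pose e k := xi 0 k - (a * omega 0 k + kappa * (d k F / F) + d k h).
have De l : \sum_k P l k * e k = 0.
  transitivity (ev l xi - (a * ev l omega + kappa * (D l F / F) + D l h)).
    rewrite /frame_coef /frame_der mulr_suml !mulr_sumr -!big_split -sumrB/=.
    by apply: eq_bigr => k' _; rewrite /e; ring.
  rewrite ev_omega DF; have [->|li] := eqVneq l i.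
    rewrite (negbTE ij) /a.
    have -> : ev i xi = (F * D i h + lam * (G * D j h) - lam * (G * ev j xi) + kappa) / F.
      by rewrite Xh; field.
    by rewrite /=; field; rewrite F0 G0.
  have [->|lj] := eqVneq l j; first by rewrite /a /=; field; rewrite F0 G0.
  by rewrite Dh//; rewrite /=; ring.
apply/eqP; rewrite -subr_eq0; apply/eqP; rewrite -/(e k).
transitivity (\sum_j (k == j)%:R * e j).
  rewrite (bigD1 k)//= eqxx mul1r big1 ?addr0// => k' /negbTE kk.
  by rewrite eq_sym kk mul0r.
under eq_bigr => k' _ do rewrite -QP mulr_suml.
rewrite exchange_big/= big1// => l _.
under eq_bigr do rewrite -mulrA.
by rewrite -mulr_sumr De mulr0.
Qed.

End RelativeForms.

(** * Meromorphic germs *)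

Lemma quotient_rule (M : fieldType) (a b p q : M) : q != 0 ->
  (a * q - p * b) / q ^+ 2 * q = a - p / q * b.
Proof. by move=> q0; field. Qed.

Lemma diff_rule (M : fieldType) (x y dx dy q s a b c e : M) :
  dx * q = a - x * b -> dy * s = c - y * e ->
  a * s + x * q * e - (b * (y * s) + q * c) - (x - y) * (b * s + q * e) =
  (dx - dy) * (q * s).
Proof.
move=> xq ys; transitivity ((dx * q) * s - q * (dy * s)); last by ring.
by rewrite xq ys; ring.
Qed.

Lemma product_rule (M : fieldType) (x y dx dy q s a b c e : M) :
  dx * q = a - x * b -> dy * s = c - y * e ->
  a * (y * s) + x * q * c - x * y * (b * s + q * e) =
  (dx * y + x * dy) * (q * s).
Proof.
move=> xq ys; transitivity ((dx * q) * (y * s) + (x * q) * (dy * s)); last by ring.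
by rewrite xq ys; ring.
Qed.

Section Meromorphic.
Variables (K : numFieldType) (m : nat).
Implicit Types (f p q : holo K m) (x y : mero K m) (k : 'I_m).

Lemma mero_der_eq k x p q : q != 0 -> x * q%:F = p%:F ->
  mero_der k x * q%:F = (holo_der k p)%:F - x * (holo_der k q)%:F.
Proof.
move=> q0 xq; have q0' : q%:F != 0 by rewrite tofrac_eq0.
have -> : x = p%:F / q%:F by rewrite -xq mulfK.
rewrite mero_derE// rmorphB rmorphXn !rmorphM/=.
exact: quotient_rule.
Qed.

Lemma mero_der_tofrac k f : mero_der k f%:F = (holo_der k f)%:F.
Proof.
have := @mero_der_eq k f%:F f 1 (oner_neq0 _); rewrite rmorph1 !mulr1.
move=> -> //; rewrite -[1]/(holoC m 1) holo_derC rmorph0.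
by rewrite mulr0 subr0.
Qed.

Lemma mero_exists x : exists p q, q != 0 /\ x * q%:F = p%:F.
Proof.
have d0 : (frac (repr x)).2 != 0 := denom_ratioP _.
exists (frac (repr x)).1, (frac (repr x)).2; split=> //.
by rewrite {1}[x]fracE divfK// tofrac_eq0.
Qed.

Lemma mero_derB k x y : mero_der k (x - y) = mero_der k x - mero_der k y.
Proof.
have [p [q [q0 xq]]] := mero_exists x; have [r [s [s0 ys]]] := mero_exists y.
have qs0 : q * s != 0 by rewrite mulf_neq0.
have e : (x - y) * (q * s)%:F = (p * s - q * r)%:F.
  by rewrite rmorphB !rmorphM/= -xq -ys; ring.
apply: (mulIf (_ : (q * s)%:F != 0)); first by rewrite tofrac_eq0.
rewrite (mero_der_eq k qs0 e) raddfB/= !holo_derM !(rmorphB, rmorphD, rmorphM)/=.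
rewrite -xq -ys.
exact: diff_rule (mero_der_eq k q0 xq) (mero_der_eq k s0 ys).
Qed.

Lemma mero_derM k x y :
  mero_der k (x * y) = mero_der k x * y + x * mero_der k y.
Proof.
have [p [q [q0 xq]]] := mero_exists x; have [r [s [s0 ys]]] := mero_exists y.
have qs0 : q * s != 0 by rewrite mulf_neq0.
have e : (x * y) * (q * s)%:F = (p * r)%:F.
  by rewrite !rmorphM/= -xq -ys; ring.
apply: (mulIf (_ : (q * s)%:F != 0)); first by rewrite tofrac_eq0.
rewrite (mero_der_eq k qs0 e) !holo_derM !(rmorphD, rmorphM)/= -xq -ys.
exact: product_rule (mero_der_eq k q0 xq) (mero_der_eq k s0 ys).
Qed.

HB.instance Definition _ k :=
  GRing.isZmodMorphism.Build (mero K m) (mero K m) (@mero_der K m k)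
    (@mero_derB k).

Lemma frame_der_tofrac (P : 'I_m -> 'I_m -> holo K m) l f :
  frame_der (@mero_der K m) (fun l k => (P l k)%:F) l f%:F =
  (frame_der (@holo_der K m) P l f)%:F.
Proof.
rewrite /frame_der rmorph_sum/=; apply: eq_bigr => k _.
by rewrite mero_der_tofrac rmorphM.
Qed.

Lemma frame_derM (P : 'I_m -> 'I_m -> mero K m) l x y :
  frame_der (@mero_der K m) P l (x * y) =
  frame_der (@mero_der K m) P l x * y + x * frame_der (@mero_der K m) P l y.
Proof.
rewrite /frame_der mulr_suml mulr_sumr -big_split/=; apply: eq_bigr => k _.
by rewrite mero_derM mulrDr !mulrA; congr (_ + _ * _); rewrite mulrC.
Qed.

(** The localisation of the ring of germs at E. *)
Definition polar (E : holo K m) x := exists n f, x * E%:F ^+ n = f%:F.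

Variables (E : holo K m).
Hypothesis E0 : E != 0.
Let E0' : E%:F != 0. Proof. by rewrite tofrac_eq0. Qed.

Lemma polar_tofrac f : polar E f%:F.
Proof. by exists 0%N, f; rewrite mulr1. Qed.

Lemma polarD x y : polar E x -> polar E y -> polar E (x + y).
Proof.
move=> [n [f xf]] [n' [g yg]]; exists (n + n')%N, (f * E ^+ n' + g * E ^+ n).
by rewrite exprD rmorphD !rmorphM !rmorphXn/= -xf -yg; ring.
Qed.

Lemma polarM x y : polar E x -> polar E y -> polar E (x * y).
Proof.
move=> [n [f xf]] [n' [g yg]]; exists (n + n')%N, (f * g).
by rewrite exprD rmorphM/= -xf -yg; ring.
Qed.

Lemma polar0 : polar E 0. Proof. by rewrite -tofrac0; apply: polar_tofrac. Qed.
Lemma polarN x : polar E x -> polar E (- x).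
Proof.
move=> [n [f xf]]; exists n, (- f).
by rewrite mulNr xf rmorphN.
Qed.

Lemma polarB x y : polar E x -> polar E y -> polar E (x - y).
Proof. by move=> ? ?; apply: polarD => //; apply: polarN. Qed.

Lemma polar_sum (I : Type) (r : seq I) (X : I -> mero K m) :
  (forall i, polar E (X i)) -> polar E (\sum_(i <- r) X i).
Proof.
by move=> XP; elim/big_ind: _ => // [|x y]; [apply: polar0|apply: polarD].
Qed.

Lemma polar_inv f g : E = f * g -> polar E (f%:F)^-1.
Proof.
move=> Efg; exists 1%N, g; rewrite expr1 Efg tofracM; apply: mulKf.
by rewrite tofrac_eq0; apply: contraNneq E0 => f0; rewrite Efg f0 mul0r.
Qed.

Lemma polar_der k x : polar E x -> polar E (mero_der k x).
Proof.
move=> [n [f xf]].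
have En : E ^+ n != 0 by rewrite expf_neq0.
have := @mero_der_eq k x f (E ^+ n) En; rewrite rmorphXn => /(_ xf) e.
exists (n + n)%N, (holo_der k f * E ^+ n - f * holo_der k (E ^+ n)).
rewrite exprD mulrA e rmorphB !rmorphM/= -xf !rmorphXn/=.
ring.
Qed.

Lemma polar_common (I : finType) (X : I -> mero K m) : (forall i, polar E (X i)) ->
  exists n (f : I -> holo K m), forall i, X i * E%:F ^+ n = (f i)%:F.
Proof.
move=> XE; have /choice[n nP] i : exists n f, X i * E%:F ^+ n = f%:F := XE i.
exists (\sum_i n i)%N.
have /choice[f fP] i : exists f, X i * E%:F ^+ (\sum_j n j) = f%:F.
  have [f fP] := nP i; exists (f * E ^+ (\sum_(j | j != i) n j)).
  by rewrite (bigD1 i)//= exprD mulrA fP rmorphM rmorphXn.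
by exists f.
Qed.

End Meromorphic.

Section Frames.
Variables (K : numFieldType) (m : nat).

(** P is the inverse of the Jacobian matrix of U, so that its rows are the
    vector fields dual to the coordinates. *)
Definition coordinates (U : 'I_m -> holo K m) (P : 'I_m -> 'I_m -> holo K m) :=
  [/\ forall l, value0 (U l) = 0,
    forall l j, \sum_k P l k * holo_der k (U j) = (l == j)%:R
  & forall k j, \sum_l holo_der k (U l) * P l j = (k == j)%:R].

Lemma general_position_neq0 (F G : holo K m) :
  general_position F G -> F != 0 /\ G != 0.
Proof.
move=> [_ _ /eqP FG]; split; apply/eqP => Z; apply: FG; apply/matrixP => i j.
  by rewrite !mxE Z !raddf0 /value0 tcoef0 !mul0r subrr.
by rewrite !mxE Z !raddf0 /value0 tcoef0 !mulr0 subrr.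
Qed.

(** A nonzero 2 x 2 minor of the Jacobian matrix of (F, G) at the origin says
    which two of the original coordinates F and G can replace. Cramer's rule for
    this minor then gives the dual frame explicitly. *)
Lemma general_position_coordinates (F G : holo K m) : general_position F G ->
  exists i j U P, [/\ i != j, U i = F, U j = G & coordinates U P].
Proof.
move=> [F0 G0 FG].
have [i [j ij0]] : exists i j, value0 (holo_der i F * holo_der j G
    - holo_der j F * holo_der i G) != 0.
  apply: contra_neqP FG => H; apply/matrixP => i j; rewrite !mxE.
  move/forallNP: H => /(_ i) /forallNP /(_ j) /negP; rewrite negbK => /eqP.
  by rewrite /value0 tcoefD tcoefN -!/(value0 _) !value0M.
have ij : i != j by apply: contraNneq ij0 => ->; rewrite subrr /value0 tcoef0.
have [u uE] := holo_unit ij0.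
pose U l := if l == i then F else if l == j then G else holo_mon K (mnm1 l).
pose Pi k := u * (holo_der j G * (k == i)%:R - holo_der i G * (k == j)%:R).
pose Pj k := u * (holo_der i F * (k == j)%:R - holo_der j F * (k == i)%:R).
pose P l k := if l == i then Pi k else if l == j then Pj k else
  (k == l)%:R - holo_der l F * Pi k - holo_der l G * Pj k.
have Ui : U i = F by rewrite /U eqxx.
have Uj : U j = G by rewrite /U eq_sym (negbTE ij) eqxx.
have sum_delta (a : 'I_m) (f : 'I_m -> holo K m) : \sum_k (k == a)%:R * f k = f a.
  rewrite (bigD1 a)//= eqxx mul1r big1 ?addr0// => k /negbTE ->.
  by rewrite mul0r.
have PiE f : \sum_k Pi k * f k = u * (holo_der j G * f i - holo_der i G * f j).
  rewrite -[f i]sum_delta -[f j]sum_delta !mulr_sumr -sumrB mulr_sumr.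
  by apply: eq_bigr => k _; rewrite /Pi; ring.
have PjE f : \sum_k Pj k * f k = u * (holo_der i F * f j - holo_der j F * f i).
  rewrite -[f i]sum_delta -[f j]sum_delta !mulr_sumr -sumrB mulr_sumr.
  by apply: eq_bigr => k _; rewrite /Pj; ring.
have PU l q : \sum_k P l k * holo_der k (U q) = (l == q)%:R.
  have PiU : \sum_k Pi k * holo_der k (U q) = (i == q)%:R.
    rewrite PiE; have [<-|iq] := eqVneq i q.
      by rewrite Ui -[RHS]uE; ring.
    have [<-|jq] := eqVneq j q; first by rewrite Uj /=; ring.
    rewrite /U eq_sym (negbTE iq) eq_sym (negbTE jq) !holo_der_mon1.
    by rewrite (negbTE iq) (negbTE jq) /=; ring.
  have PjU : \sum_k Pj k * holo_der k (U q) = (j == q)%:R.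
    rewrite PjE; have [<-|jq] := eqVneq j q.
      by rewrite Uj -[RHS]uE; ring.
    have [<-|iq] := eqVneq i q; first by rewrite Ui /=; ring.
    rewrite /U eq_sym (negbTE iq) eq_sym (negbTE jq) !holo_der_mon1.
    by rewrite (negbTE iq) (negbTE jq) /=; ring.
  rewrite /P; have [->//|li] := eqVneq l i.
  have [->//|lj] := eqVneq l j.
  transitivity (\sum_k (k == l)%:R * holo_der k (U q)
      - holo_der l F * (\sum_k Pi k * holo_der k (U q))
      - holo_der l G * (\sum_k Pj k * holo_der k (U q))).
    by rewrite !mulr_sumr -!sumrB; apply: eq_bigr => k _; ring.
  rewrite sum_delta PiU PjU; have [<-|iq] := eqVneq i q.
    by rewrite Ui [j == i]eq_sym (negbTE ij) (negbTE li) /=; ring.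
  have [<-|jq] := eqVneq j q; first by rewrite Uj (negbTE lj) /=; ring.
  rewrite /U eq_sym (negbTE iq) eq_sym (negbTE jq) holo_der_mon1.
  by rewrite !mulr0 !subr0.
exists i, j, U, P; split=> //; split=> // [l|k q].
  rewrite /U; case: eqP => // _; case: eqP => // _.
  by rewrite /value0 /= /ps_mon eq_sym mnm1_eq0.
pose PM := \matrix_(l, k) P l k; pose JM := \matrix_(k, l) holo_der k (U l).
have /mulmx1C/matrixP/(_ k q) : PM *m JM = 1%:M.
  by apply/matrixP => a b; rewrite !mxE -PU; apply: eq_bigr => c _; rewrite !mxE.
by rewrite !mxE => <-; apply: eq_bigr => c _; rewrite !mxE.
Qed.

End Frames.

(** * Relative cohomology *)

Section Solve.
Variables (K : numFieldType) (m : nat) (U : 'I_m -> holo K m).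
Variables (P : 'I_m -> 'I_m -> holo K m).
Hypothesis UP : coordinates U P.
Variables (i j : 'I_m) (lam : K) (n : nat).
Hypothesis ij : i != j.
Hypothesis lam_dioph : dioph_pow lam.
Implicit Types f g : holo K m.
Local Notation D := (frame_der (@holo_der K m) P).
Local Notation F := (U i).
Local Notation G := (U j).

(** The derivation F D_i + lam G D_j, which kills log G - lam log F. *)
Definition tangent f : holo K m := F * D i f + holoC m lam * (G * D j f).

Let U0 : forall l, value0 (U l) = 0. Proof. by case: UP. Qed.
Let PU : forall l j, \sum_k P l k * holo_der k (U j) = (l == j)%:R.
Proof. by case: UP. Qed.
Let PUC : forall k j, \sum_l holo_der k (U l) * P l j = (k == j)%:R.
Proof. by case: UP. Qed.

Lemma tangentM f g : tangent (f * g) = tangent f * g + f * tangent g.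
Proof. by rewrite /tangent !fderM; ring. Qed.

Lemma tangentX f c e : tangent f = holoC m c * f ->
  tangent (f ^+ e) = holoC m (e%:R * c) * f ^+ e.
Proof.
move=> tf; elim: e => [|e IH].
  rewrite expr0 mul0r rmorph0 mul0r -(rmorph1 (@holoC K m)).
  by rewrite /tangent !fderC !mulr0 addr0.
rewrite exprS tangentM tf IH -natr1 mulrDl mul1r rmorphD/=; ring.
Qed.

Lemma tangent_FG : tangent (F * G) = holoC m (1 + lam) * (F * G).
Proof.
rewrite /tangent !fderM !(fderU PU) !eqxx (negbTE ij) eq_sym (negbTE ij).
by rewrite rmorphD rmorph1 /=; ring.
Qed.

(** Composition with the coordinates is a bijection turning euler into the
    left-hand side, so the linear model applies. *)
Lemma frame_solve (A : holo K m) (C : 'I_m -> holo K m) :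
  (forall l, l != i -> l != j ->
     tangent (C l) - holoC m (n%:R * (1 + lam)) * C l = D l A) ->
  (forall k l, k != i -> k != j -> l != i -> l != j -> D k (C l) = D l (C k)) ->
  exists (h : holo K m) (kappa : K),
    tangent h - holoC m (n%:R * (1 + lam)) * h = A - holoC m kappa * (F * G) ^+ n
    /\ forall l, l != i -> l != j -> D l h = C l.
Proof.
move=> EC CC; pose phi := holo_comp U0.
have phiE f : tangent (phi f) - holoC m (n%:R * (1 + lam)) * phi f =
    phi (euler i j lam n f).
  rewrite /tangent !(fder_comp U0 PU) /euler /phi raddfB raddfD/= !holo_compM.
  by rewrite !holo_compC !holo_comp_mon1.
have phiK f : exists g, f = phi g.
  by exists (taylor P f); rewrite /phi (taylorK U0 PU PUC).
have [A' AE] := phiK A; have /choice[C' CE] l := phiK (C l).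
have phiI := @holo_comp_inj _ _ U P U0 PU : injective phi.
have [|k l ki kj li lj|h [kappa [hE hD]]] :=
  @model_solve K m i j lam n ij lam_dioph A' C'.
- move=> l li lj; apply: phiI; rewrite -/(phi _) -phiE -CE EC// AE.
  by rewrite /phi (fder_comp U0 PU).
- by apply: phiI; rewrite /phi -!(fder_comp U0 PU) -!/(phi _) -!CE CC.
exists (phi h), kappa; split=> [|l li lj]; last first.
  by rewrite /phi (fder_comp U0 PU) hD// CE.
rewrite phiE hE /phi raddfB/= holo_compM holo_compC AE; congr (_ - _ * _).
have phiX l e : phi (holo_mon K (mnm_muln (mnm1 l) e)) = U l ^+ e.
  elim: e => [|e IH]; last first.
    by rewrite mulmS holo_monD /phi holo_compM holo_comp_mon1 exprS -IH.
  rewrite -[RHS](holo_compC U0 1); congr (phi _); apply: holoP => a.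
  by rewrite mulm0n /= /ps_mon /ps_const; case: eqP.
by rewrite /reson holo_monD /phi holo_compM -!/(phi _) !phiX exprMn.
Qed.

End Solve.

Lemma leibniz_comb (M : comPzRingType) (f g lam x y dix djx diy djy : M) :
  f * (dix * y + x * diy) + lam * (g * (djx * y + x * djy)) =
  (f * dix + lam * (g * djx)) * y + x * (f * diy + lam * (g * djy)).
Proof. by ring. Qed.

Lemma comb_mull (M : comPzRingType) (f g lam x y z : M) :
  (f * x + lam * (g * y)) * z = f * (x * z) + lam * (g * (y * z)).
Proof. by ring. Qed.

Section Cohomology.
Variables (K : numFieldType) (m : nat).

(** The hypothesis means that xi is closed along the foliation omega = 0. The
    form kappa dF/F removes the obstruction to integrating it along this
    foliation, and the Diophantine condition makes the primitive h converge.
    What remains vanishes along the foliation, so it is a multiple of omega. *)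
Lemma relative_cohomology (F G : holo K m) (lam : K) (xi : 'rV[mero K m]_m) :
  general_position F G -> dioph_pow lam ->
  let omega := log_form (@mero_der K m) F%:F G%:F (holoC m lam)%:F in
  (forall k, polar (F * G) (xi 0 k)) ->
  (forall a b c, wedge12 omega (diff1 (@mero_der K m) xi) a b c = 0) ->
  exists (a h : mero K m) (kappa : K),
    [/\ polar (F * G) a, polar (F * G) h &
      forall k, xi 0 k = a * omega 0 k
        + (holoC m kappa)%:F * (mero_der k F%:F / F%:F) + mero_der k h].
Proof.
move=> gp ld omega xiP xi_closed.
have [i [j [U [P [ij Ui Uj UP]]]]] := general_position_coordinates gp.
have [U0 PU PUC] := UP.
have [F0 G0] := general_position_neq0 gp.
have E0 : F * G != 0 by rewrite mulf_neq0.
have F0' : F%:F != 0 by rewrite tofrac_eq0.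
have G0' : G%:F != 0 by rewrite tofrac_eq0.
have [n [f fP]] := polar_common xiP.
(* Multiplying by N = (F G)^n brings everything back to holomorphic germs. *)
pose Pm l k := (P l k)%:F; pose Qm k l := (holo_der k (U l))%:F.
pose N := (F * G)%:F ^+ n; pose lm := (holoC m lam)%:F.
pose w := holoC m (n%:R * (1 + lam)).
have FG0 : (F * G)%:F != 0 by rewrite tofrac_eq0.
have N0 : N != 0 := expf_neq0 n FG0.
have NE : N = ((F * G) ^+ n)%:F by rewrite rmorphXn.
have QPm k l : \sum_l' Qm k l' * Pm l' l = (k == l)%:R.
  rewrite -(rmorph_nat (@FracField.tofrac _)) -PUC rmorph_sum/=.
  by apply: eq_bigr => l' _; rewrite tofracM.
pose dm := @mero_der K m; pose D := frame_der dm Pm.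
pose Dh := frame_der (@holo_der K m) P.
have DE l g : D l g%:F = (Dh l g)%:F by apply: frame_der_tofrac.
have DM l x y : D l (x * y) = D l x * y + x * D l y by apply: frame_derM.
have DhF l : Dh l F = (l == i)%:R by rewrite -Ui; apply: fderU.
have DhG l : Dh l G = (l == j)%:R by rewrite -Uj; apply: fderU.
have DF l : D l F%:F = (l == i)%:R by rewrite DE DhF rmorph_nat.
have DG l : D l G%:F = (l == j)%:R by rewrite DE DhG rmorph_nat.
have DPm a b k : D a (Pm b k) = D b (Pm a k).
  by rewrite /Pm !DE /Dh (fderP PU PUC).
have dlam k : dm k lm = 0 by rewrite /dm /lm mero_der_tofrac holo_derC rmorph0.
pose Cm l := frame_coef Pm l xi; pose C l := \sum_k P l k * f k.
have CmN l : Cm l * N = (C l)%:F.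
  rewrite /Cm /frame_coef /C mulr_suml rmorph_sum/=; apply: eq_bigr => k _.
  by rewrite tofracM -fP mulrA.
pose X x := F%:F * D i x + lm * (G%:F * D j x).
have XE g : X g%:F = (tangent U P i j lam g)%:F.
  by rewrite /X !DE /tangent Ui Uj tofracD !tofracM.
have XM x y : X (x * y) = X x * y + x * X y.
  by rewrite /X !DM; apply: leibniz_comb.
have XN : X N = w%:F * N.
  rewrite NE XE -tofracM -Ui -Uj; congr (_%:F).
  by apply: tangentX; apply: tangent_FG.
have DN l : l != i -> l != j -> D l N = 0.
  move=> /negbTE li /negbTE lj; rewrite /N; elim: n {fP N N0 NE CmN w XN} => [|e IH].
    by rewrite expr0 -tofrac1 DE -(rmorph1 (@holoC K m)) /Dh fderC rmorph0.
  rewrite exprS DM IH mulr0 addr0 DE /Dh fderM -!/(Dh _ _) DhF DhG li lj.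
  by rewrite mul0r mulr0 addr0 rmorph0 mul0r.
pose Am := F%:F * Cm i + lm * (G%:F * Cm j).
pose A := F * C i + holoC m lam * (G * C j).
have AmN : Am * N = A%:F.
  by rewrite /Am /A tofracD !tofracM -!CmN; apply: comb_mull.
have tang l : l != i -> l != j -> X (Cm l) = D l Am.
  exact: (frame_tangent (@mero_derB K m) (@mero_derM K m) DPm ij F0' G0'
    DF DG dlam xi_closed).
have clos k l : k != i -> k != j -> l != i -> l != j -> D k (Cm l) = D l (Cm k).
  exact: (frame_closed (@mero_derB K m) (@mero_derM K m) DPm ij F0' G0' DF DG xi_closed).
have tinj (g1 g2 : holo K m) : g1%:F = g2%:F -> g1 = g2.
  by move=> /eqP; rewrite tofrac_eq => /eqP.
have [l li lj|k l ki kj li lj|h [kappa [hE hD]]] :=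
  @frame_solve K m U P UP i j lam n ij ld A C.
- apply: tinj; rewrite -/(Dh _ _) -DE -AmN DM DN// mulr0 addr0 -tang//.
  rewrite tofracB -XE -CmN XM XN tofracM -CmN.
  by rewrite mulrCA addrK.
- apply: tinj; rewrite -/(Dh _ _) -DE -CmN DM DN// mulr0 addr0 clos//.
  by rewrite -/(Dh _ _) -DE -CmN DM DN// mulr0 addr0.
pose hm := h%:F / N; have hmN : hm * N = h%:F by rewrite /hm divfK.
pose a := G%:F * (Cm j - D j hm).
have polar_sumD l x : polar (F * G) x -> polar (F * G) (D l x).
  move=> xp; apply: polar_sum => // k; apply: polarM; first exact: polar_tofrac.
  exact: polar_der.
have polar_h : polar (F * G) hm by exists n, h.
exists a, hm, kappa; split=> //.
  apply: polarM; first exact: polar_tofrac.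
  apply: polarB; last exact: polar_sumD.
  apply: polar_sum => k; apply: polarM; first exact: polar_tofrac.
  exact: xiP.
apply: (frame_decomp QPm ij F0' G0' DF DG (h := hm)
  (kappa := (holoC m kappa)%:F)).
- rewrite -/(Cm i) -/(Cm j) -/Am; apply: (mulIf N0).
  rewrite mulrBl AmN -[LHS]/(X hm * N).
  have -> : X hm * N = X (hm * N) - hm * X N.
    by apply/esym/(canLR (addrK _)); apply: XM.
  rewrite hmN XE XN mulrCA hmN -tofracM -tofracB hE Ui Uj.
  by rewrite tofracB tofracM NE.
- move=> l li lj; apply: (mulIf N0); rewrite -/(Cm l) CmN -hD//.
  by rewrite -/(Dh _ _) -DE -hmN DM DN// mulr0 addr0.
Qed.

End Cohomology.

(** * Derivations, integrability and the obstruction at order n *)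

Section Derivations.
Variables (A : comNzRingType) (m : nat) (d : 'I_m -> A -> A).
Hypothesis dB : forall k x y, d k (x - y) = d k x - d k y.
Hypothesis dM : forall k x y, d k (x * y) = d k x * y + x * d k y.
Implicit Types v w : 'rV[A]_m.

Lemma der0 k : d k 0 = 0. Proof. by rewrite -[0 in LHS](subrr 0) dB subrr. Qed.

Lemma derD k x y : d k (x + y) = d k x + d k y.
Proof. by rewrite -[y in LHS]opprK -[- y]sub0r !dB der0 sub0r opprK. Qed.

Lemma der_sum k (I : Type) (r : seq I) (f : I -> A) :
  d k (\sum_(x <- r) f x) = \sum_(x <- r) d k (f x).
Proof. by apply: (big_morph (d k)) => [x y|]; [apply: derD|apply: der0]. Qed.

(** Integrability of a form only depends on the hyperplanes it defines. *)
Lemma wedge12_scale u v a b c :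
  wedge12 (u *: v) (diff1 d (u *: v)) a b c = u ^+ 2 * wedge12 v (diff1 d v) a b c.
Proof. by rewrite /wedge12 !mxE !dM; ring. Qed.

(** If v is closed and s constant, then d (v + s w) = s d w. *)
Lemma wedge12_closed_add s v w a b c : (forall k, d k s = 0) ->
  (forall i j, diff1 d v i j = 0) ->
  wedge12 (v + s *: w) (diff1 d (v + s *: w)) a b c =
  s * wedge12 (v + s *: w) (diff1 d w) a b c.
Proof.
move=> ds dv.
have E i j : diff1 d (v + s *: w) i j = s * diff1 d w i j.
  have := dv i j; rewrite !mxE !derD !dM !ds !mul0r !add0r => e.
  rewrite opprD addrACA; rewrite e; ring.
by rewrite /wedge12 !E; ring.
Qed.

Hypothesis dC : forall i j x, d i (d j x) = d j (d i x).

Lemma closed_exact h i j : diff1 d (diff0 d h) i j = 0.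
Proof. by rewrite !mxE dC subrr. Qed.

Lemma closed_scale_add c v w i j : (forall k, d k c = 0) ->
  (forall i j, diff1 d v i j = 0) -> (forall i j, diff1 d w i j = 0) ->
  diff1 d (c *: v + w) i j = 0.
Proof.
move=> dc dv dw; have := dv i j; have := dw i j.
rewrite !mxE !derD !dM !dc !mul0r !add0r => /eqP; rewrite subr_eq0 => /eqP ->.
by move=> /eqP; rewrite subr_eq0 => /eqP ->; rewrite subrr.
Qed.

(** A logarithmic differential v = d F / F is closed. *)
Lemma closed_log F v : (forall k, v 0 k * F = d k F) -> GRing.lreg F ->
  forall i j, diff1 d v i j = 0.
Proof.
move=> vF Freg i j; apply: Freg; rewrite mulr0 !mxE mulrBr.
have E i' j' : F * d i' (v 0 j') = d i' (d j' F) - v 0 j' * d i' F.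
  by rewrite -vF dM -addrA [_ * d i' F]mulrC [F * _]mulrC; ring.
by rewrite !E dC -!vF; ring.
Qed.

Definition polyder k (p : {poly A}) : {poly A} := map_poly (d k) p.

Lemma coef_polyder k p n : (polyder k p)`_n = d k p`_n.
Proof. by rewrite coef_map_id0// der0. Qed.

Lemma polyderB k p q : polyder k (p - q) = polyder k p - polyder k q.
Proof. by apply/polyP => n; rewrite coefB !coef_polyder coefB dB. Qed.

Lemma polyderM k p q : polyder k (p * q) = polyder k p * q + p * polyder k q.
Proof.
apply/polyP => n; rewrite coefD coef_polyder !coefM der_sum -big_split/=.
by apply: eq_bigr => i _; rewrite dM !coef_polyder.
Qed.

Lemma polyderC k c : polyder k c%:P = (d k c)%:P.
Proof.
apply/polyP => n; rewrite coef_polyder !coefC.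
by case: ifP; rewrite ?der0.
Qed.

Lemma der1 k : d k 1 = 0.
Proof.
have := dM k 1 1; rewrite !mulr1 mul1r => /eqP.
by rewrite -subr_eq0 opprD addNKr oppr_eq0 => /eqP.
Qed.

Lemma polyderXn k n : polyder k 'X^n = 0.
Proof.
apply/polyP => i; rewrite coef_polyder coefXn coef0.
by case: eqP; rewrite ?der0 ?der1.
Qed.

Definition eq_upto n (p q : {poly A}) := forall k, (k <= n)%N -> p`_k = q`_k.

Lemma eq_uptoD n p p' q q' : eq_upto n p p' -> eq_upto n q q' ->
  eq_upto n (p + q) (p' + q').
Proof. by move=> e f k kn; rewrite !coefD e// f. Qed.

Lemma eq_uptoB n p p' q q' : eq_upto n p p' -> eq_upto n q q' ->
  eq_upto n (p - q) (p' - q').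
Proof. by move=> e f k kn; rewrite !coefB e// f. Qed.

Lemma eq_uptoM n p p' q q' : eq_upto n p p' -> eq_upto n q q' ->
  eq_upto n (p * q) (p' * q').
Proof.
move=> e f k kn; rewrite !coefM; apply: eq_bigr => i _.
by rewrite e ?f// (leq_trans _ kn) ?leq_subr// -ltnS ltn_ord.
Qed.

Lemma eq_upto_der n k p q : eq_upto n p q -> eq_upto n (polyder k p) (polyder k q).
Proof. by move=> e i ien; rewrite !coef_polyder e. Qed.

Lemma eq_upto_wedge12 n (v w : 'rV[{poly A}]_m) a b c :
  (forall k, eq_upto n (v 0 k) (w 0 k)) ->
  eq_upto n (wedge12 v (diff1 polyder v) a b c) (wedge12 w (diff1 polyder w) a b c).
Proof.
move=> vw; have E i j : eq_upto n (diff1 polyder v i j) (diff1 polyder w i j).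
  by rewrite !mxE; apply: eq_uptoB; apply: eq_upto_der.
by apply: eq_uptoD; [apply: eq_uptoB|]; apply: eq_uptoM.
Qed.

End Derivations.

Section FormalStep.
Variables (M : fieldType) (m : nat) (d : 'I_m -> M -> M).
Hypothesis dB : forall k x y, d k (x - y) = d k x - d k y.
Hypothesis dM : forall k x y, d k (x * y) = d k x * y + x * d k y.

(** Up to order n the family is E U (eta + t^n xi). Integrability does not see
    the factor E U, and since eta is closed the first coefficient that may not
    vanish is that of t^n, namely eta_0 /\ d xi. *)
Lemma obstruction_closed (Om : nat -> 'rV[M]_m) (E : M) (U : {poly M})
    (eta : 'rV[{poly M}]_m) (n : nat) (xi : 'rV[M]_m) :
  (0 < n)%N -> E != 0 -> U`_0 = 1 ->
  (forall i j, diff1 (polyder d) eta i j = 0) ->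
  (forall k c, (k < n)%N -> Om k 0 c = E * (U * eta 0 c)`_k) ->
  (forall c, Om n 0 c = E * ((U * eta 0 c)`_n + xi 0 c)) ->
  (forall a b c, (wedge12 (\row_i \poly_(k < n.+1) Om k 0 i)
    (diff1 (polyder d) (\row_i \poly_(k < n.+1) Om k 0 i)) a b c)`_n = 0) ->
  forall a b c, wedge12 (\row_i (eta 0 i)`_0) (diff1 d xi) a b c = 0.
Proof.
move=> n0 E0 U0 eta_closed Ok On integ a b c.
pose X := 'X^n : {poly M}; pose xiP := map_mx polyC xi.
pose v := (E%:P * U) *: (eta + X *: xiP).
have vO i : eq_upto n ((\row_i \poly_(k < n.+1) Om k 0 i) 0 i) (v 0 i).
  move=> k kn; rewrite !mxE coef_poly ltnS kn -mulrA coefCM mulrDr coefD.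
  rewrite mulrCA coefXnM coefMC; have [kn'|] := ltnP k n; first by rewrite addr0 Ok.
  rewrite leq_eqVlt ltnNge kn orbF => /eqP <-.
  by rewrite subnn U0 mul1r On.
have := integ a b c; rewrite (eq_upto_wedge12 dB a b c vO (leqnn n)) /v.
rewrite (wedge12_scale (polyderM dB dM)).
rewrite (wedge12_closed_add (polyderB dB) (polyderM dB dM))//; last first.
  by move=> k; apply: polyderXn dM _ _.
rewrite mulrCA coefXnM ltnn subnn coef0M expr2 coef0M coefCM U0 mulr1 => /eqP.
rewrite !mulf_eq0 (negbTE E0)/= => /eqP e; apply: etrans e.
rewrite /wedge12.
have diffE i j : diff1 (polyder d) xiP i j = (diff1 d xi i j)%:P.
  by rewrite !mxE !(polyderC dB) polyCB.
rewrite !diffE coefD coefB !coefMC.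
have cE i : ((eta + X *: xiP) 0 i)`_0 = (\row_i (eta 0 i)`_0) 0 i.
  by rewrite !mxE coefD coefXnM n0 addr0.
by rewrite !cE.
Qed.

End FormalStep.

(** * Taylor expansion of a family of integrable forms *)

Section Asymptotics.
Variable K : numFieldType.
Implicit Types (f g : K -> K) (p q : {poly K}) (N : nat).

(** An asymptotic expansion at 0 along the positive t, which suffice to determine
    the coefficients of p up to order N. *)
Definition asym N f p := exists r C : K, [/\ 0 < r, 0 <= C &
  forall t, 0 < t -> t < r -> `|f t - p.[t]| <= C * t ^+ N.+1].

Lemma pos_min (x y : K) : 0 < x -> 0 < y -> exists z, [/\ 0 < z, z <= x & z <= y].
Proof.
move=> x0 y0; have [h|h] := real_leP (gtr0_real x0) (gtr0_real y0).
  by exists x; rewrite h lexx x0.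
by exists y; rewrite (ltW h) lexx y0.
Qed.

Lemma horner_bounded p : exists2 B : K, 0 <= B &
  forall t, 0 <= t -> t <= 1 -> `|p.[t]| <= B.
Proof.
elim/poly_ind: p => [|p c [B B0 pB]].
  by exists 0 => // t _ _; rewrite horner0 normr0.
exists (B + `|c|) => [|t t0 t1]; first by rewrite addr_ge0.
rewrite hornerMXaddC; apply: le_trans (ler_normD _ _) _; rewrite lerD2r.
by rewrite normrM (ger0_norm t0) -[leRHS]mulr1 ler_pM// pB.
Qed.

Lemma asymD N f g p q : asym N f p -> asym N g q ->
  asym N (fun t => f t + g t) (p + q).
Proof.
move=> [r [C [r0 C0 fp]]] [s [B [s0 B0 gq]]]; have [z [z0 zr zs]] := pos_min r0 s0.
exists z, (C + B); split=> [//||t t0 tz]; first by rewrite addr_ge0.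
rewrite hornerD opprD addrACA mulrDl; apply: le_trans (ler_normD _ _) _.
by rewrite lerD ?fp ?gq// (lt_le_trans tz).
Qed.

Lemma asym_const N c : asym N (fun=> c) c%:P.
Proof.
by exists 1, 0; split=> // t _ _; rewrite hornerC subrr normr0 mul0r.
Qed.

Lemma asymN N f p : asym N f p -> asym N (fun t => - f t) (- p).
Proof.
move=> [r [C [r0 C0 fp]]]; exists r, C; split=> // t t0 tr.
by rewrite hornerN -opprD normrN fp.
Qed.

Lemma asymM N f g p q : asym N f p -> asym N g q ->
  asym N (fun t => f t * g t) (p * q).
Proof.
move=> [r [C [r0 C0 fp]]] [s [B [s0 B0 gq]]]; have [z' [z0' zr zs]] := pos_min r0 s0.
have [z [z0 zz z1]] := pos_min z0' ltr01.
have [Bp Bp0 pB] := horner_bounded p; have [Bq Bq0 qB] := horner_bounded q.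
exists z, (C * B + C * Bq + Bp * B); split=> [//||t t0 tz].
  by rewrite !addr_ge0// mulr_ge0.
have t1 : t <= 1 by rewrite (le_trans (ltW tz)).
have {}fp : `|f t - p.[t]| <= C * t ^+ N.+1.
  by rewrite fp// (lt_le_trans tz)// (le_trans zz).
have {}gq : `|g t - q.[t]| <= B * t ^+ N.+1.
  by rewrite gq// (lt_le_trans tz)// (le_trans zz).
have {}pB := pB t (ltW t0) t1; have {}qB := qB t (ltW t0) t1.
have T0 : 0 <= t ^+ N.+1 by rewrite exprn_ge0// ltW.
have T1 : t ^+ N.+1 <= 1 by rewrite exprn_ile1// ltW.
rewrite hornerM.
have -> : f t * g t - p.[t] * q.[t] = (f t - p.[t]) * (g t - q.[t])
  + (f t - p.[t]) * q.[t] + p.[t] * (g t - q.[t]) by ring.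
rewrite [leRHS]mulrDl [X in _ <= X + _]mulrDl.
apply: le_trans (ler_normD _ _) _; apply: lerD.
  apply: le_trans (ler_normD _ _) _; rewrite !normrM; apply: lerD.
    rewrite -[leRHS]mulrA; apply: ler_pM => //.
    by apply: le_trans fp _; rewrite ler_piMr.
  by rewrite mulrAC ler_pM.
by rewrite normrM -mulrA ler_pM.
Qed.

Lemma asym_sum N (I : Type) (s : seq I) (P : pred I) (f : I -> K -> K)
    (p : I -> {poly K}) : (forall i, asym N (f i) (p i)) ->
  asym N (fun t => \sum_(i <- s | P i) f i t) (\sum_(i <- s | P i) p i).
Proof.
move=> fp; elim: s => [|i s IH].
  by under eq_fun do rewrite big_nil; rewrite big_nil; apply: (asym_const N 0).
under eq_fun do rewrite big_cons; rewrite big_cons.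
by case: (P i) => //; apply: asymD.
Qed.

Lemma small_eq0 (c B r : K) : 0 < r -> 0 <= B ->
  (forall t, 0 < t -> t < r -> `|c| <= B * t) -> c = 0.
Proof.
move=> r0 B0 H; apply/eqP; apply/negPn/negP => c0.
have c0' : 0 < `|c| by rewrite normr_gt0.
have B1 : 0 < B + 1 by rewrite ltr_wpDl.
have [z [z0 zr zc]] := pos_min r0 (divr_gt0 c0' B1).
have h0 : 0 < z / 2 by rewrite divr_gt0.
have hz : z / 2 < z by rewrite ltr_pdivrMr// ltr_pMr// ltr1n.
have cB : B * (z / 2) < `|c|.
  apply: le_lt_trans (_ : (B + 1) * (z / 2) < _).
    by rewrite ler_pM2r// lerDl.
  apply: lt_le_trans (_ : (B + 1) * z <= _); first by rewrite ltr_pM2l.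
  by rewrite mulrC -ler_pdivlMr.
by have := le_lt_trans (H _ h0 (lt_le_trans hz zr)) cB; rewrite ltxx.
Qed.

(** The constant term is O(t), hence zero; then divide by t. *)
Lemma asym_eq0 N p : asym N (fun=> 0) p -> forall k, (k <= N)%N -> p`_k = 0.
Proof.
elim/poly_ind: p N => [|p c IH] N; first by move=> _ k _; rewrite coef0.
move=> [r [C [r0 C0 H]]].
have {}H t : 0 < t -> t < r -> `|p.[t] * t + c| <= C * t ^+ N.+1.
  by move=> t0 tr; have := H t t0 tr; rewrite sub0r normrN hornerMXaddC.
have [B B0 pB] := horner_bounded p.
have [z [z0 zr z1]] := pos_min r0 ltr01.
have c0 : c = 0.
  apply: (@small_eq0 c (C + B) z) => // [|t t0 tz]; first exact: addr_ge0.
  have t1 : t <= 1 by apply: ltW; apply: lt_le_trans z1.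
  have -> : c = (p.[t] * t + c) - p.[t] * t by ring.
  apply: le_trans (ler_normB _ _) _; rewrite mulrDl; apply: lerD.
    apply: le_trans (H t t0 (lt_le_trans tz zr)) _.
    rewrite ler_wpM2l// exprS -[leRHS]mulr1 ler_wpM2l ?exprn_ile1// ltW//.
  by rewrite normrM (gtr0_norm t0) ler_wpM2r ?pB// ltW.
move=> k kN; rewrite coefD coefMX coefC c0; case: k kN => [|k] kN.
  by rewrite /= addr0.
rewrite /= addr0; case: N kN H => [//|N] kN H.
apply: (IH N) => //; exists r, C; split=> // t t0 tr.
have := H t t0 tr; rewrite c0 addr0 normrM (gtr0_norm t0) exprSr mulrA.
by rewrite ler_pM2r// sub0r normrN.
Qed.

End Asymptotics.

Section Families.
Variables (K : numFieldType) (m : nat).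
Implicit Types (f g : K -> holo K m) (p q : {poly holo K m}) (N : nat).

Definition cpoly (a : multinom m) p : {poly K} := map_poly (fun h : holo K m => h a) p.

Lemma coef_cpoly a p k : (cpoly a p)`_k = p`_k a.
Proof. by rewrite coef_map_id0// tcoef0. Qed.

(** The expansion is required of each Taylor coefficient separately: each
    coefficient of a polynomial expression in the germs and their derivatives
    depends on finitely many of them. *)
Definition hasym N f p := forall a, asym N (fun t => f t a) (cpoly a p).

Lemma hasymD N f g p q : hasym N f p -> hasym N g q ->
  hasym N (fun t => f t + g t) (p + q).
Proof.
move=> fp gq a; have -> : cpoly a (p + q) = cpoly a p + cpoly a q.
  by apply/polyP => k; rewrite coefD !coef_cpoly coefD.
exact: asymD (fp a) (gq a).
Qed.

Lemma hasymN N f p : hasym N f p -> hasym N (fun t => - f t) (- p).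
Proof.
move=> fp a; have -> : cpoly a (- p) = - cpoly a p.
  by apply/polyP => k; rewrite coefN !coef_cpoly coefN.
exact: asymN (fp a).
Qed.

Lemma hasymB N f g p q : hasym N f p -> hasym N g q ->
  hasym N (fun t => f t - g t) (p - q).
Proof. by move=> fp gq; apply: hasymD => //; apply: hasymN. Qed.

Lemma hasymM N f g p q : hasym N f p -> hasym N g q ->
  hasym N (fun t => f t * g t) (p * q).
Proof.
move=> fp gq a.
have -> : cpoly a (p * q) = \sum_(k : bmultinom m (mdeg a).+1 | lem k a)
    cpoly k p * cpoly (mnm_sub a k) q.
  apply/polyP => n; rewrite coef_sum coef_cpoly coefM tcoef_sum.
  under [RHS]eq_bigr do rewrite coefM.
  rewrite [RHS]exchange_big/=; apply: eq_bigr => i _.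
  by rewrite /ps_mul; apply: eq_bigr => k _; rewrite !coef_cpoly.
apply: (@asym_sum _ N _ _ _ (fun (k : bmultinom m (mdeg a).+1) t =>
  f t k * g t (mnm_sub a k))) => k.
exact: asymM (fp k) (gq _).
Qed.

Local Notation pder := (polyder (@holo_der K m)).

Lemma hasym_der N i f p : hasym N f p ->
  hasym N (fun t => holo_der i (f t)) (pder i p).
Proof.
move=> fp a; rewrite /= /ps_der.
have -> : cpoly a (pder i p) = ((a i).+1%:R)%:P * cpoly (mnm_add a (mnm1 i)) p.
  apply/polyP => k; rewrite coefCM !coef_cpoly.
  rewrite (coef_polyder (fun k => raddfB (holo_der k))).
  by rewrite /= /ps_der.
apply: asymM; [exact: asym_const|exact: fp].
Qed.

Lemma hasym_eq0 N f p : (exists2 r : K, 0 < r & forall t, 0 < t -> t < r -> f t = 0) ->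
  hasym N f p -> forall k, (k <= N)%N -> p`_k = 0.
Proof.
move=> [r r0 f0] fp k kN; apply: holoP => a; rewrite tcoef0 -coef_cpoly.
apply: (@asym_eq0 _ N) => //; have [s [C [s0 C0 H]]] := fp a.
have [z [z0 zr zs]] := pos_min r0 s0.
exists z, C; split=> // t t0 tz; have := H t t0 (lt_le_trans tz zs).
by rewrite f0 ?tcoef0// (lt_le_trans tz).
Qed.

Variables (W : K -> 'rV[holo K m]_m) (w : nat -> 'rV[holo K m]_m).

Definition jet N : 'rV[{poly holo K m}]_m := \row_i \poly_(k < N.+1) w k 0 i.

Lemma near0_pos (P : K -> Prop) : (\forall t \near (0 : K), P t) ->
  exists2 r : K, 0 < r & forall t, 0 < t -> t < r -> P t.
Proof.
move=> /nbhs_ballP[r r0 rP]; exists r => // t t0 tr; apply: rP.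
by rewrite /ball/= sub0r normrN gtr0_norm.
Qed.

(** The remainder of the series in t is dominated by a geometric series of ratio
    t / r, which is at most 1/2. *)
Lemma analytic_hasym N : analytic_family W w ->
  forall i, hasym N (fun t => W t 0 i) (jet N 0 i).
Proof.
move=> [[r [M [r0 wM]]] /near0_pos[s s0 wcvg]] i a.
have [z [z0 zr zs]] := pos_min (divr_gt0 r0 (ltr0n _ 2)) s0.
have M0 : 0 <= M by apply: le_trans (wM 0%N i a); rewrite mulr_ge0// exprn_ge0// ltW.
pose B := M / r ^+ (N.+1 + mdeg a).
have B0 : 0 <= B by rewrite divr_ge0// exprn_ge0// ltW.
exists z, (1 + B * 2); split=> // [|t t0 tz]; first by rewrite addr_ge0// mulr_ge0.
have T0 : 0 < t ^+ N.+1 by rewrite exprn_gt0.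
have /cvgrPdist_lt/(_ _ T0)[n _ nP] := wcvg t t0 (lt_le_trans tz zs) i a.
have := nP (n + N.+1)%N (leq_addr _ _); set S := series _ _ => WS.
have -> : W t 0 i a - (cpoly a (jet N 0 i)).[t] =
  (W t 0 i a - S) + (S - (cpoly a (jet N 0 i)).[t]) by rewrite addrA subrK.
rewrite mulrDl mul1r; apply: le_trans (ler_normD _ _) _; apply: lerD.
  exact: ltW.
have -> : S - (cpoly a (jet N 0 i)).[t] =
    \sum_(l < n) t ^+ (l + N.+1) * w (l + N.+1)%N 0 i a.
  have -> : cpoly a (jet N 0 i) = \poly_(k < N.+1) w k 0 i a.
    apply/polyP => k; rewrite coef_cpoly /jet mxE !coef_poly.
    by case: ifP; rewrite ?tcoef0.
  rewrite horner_poly /S /series /= addnC big_mkord big_split_ord/=.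
  under eq_bigr do rewrite mulrC.
  by rewrite addrAC subrr add0r; apply: eq_bigr => l _; rewrite addnC.
apply: le_trans (ler_norm_sum _ _ _) _.
apply: le_trans (_ : \sum_(l < n) B * t ^+ N.+1 * 2^-1 ^+ l <= _); last first.
  by rewrite -mulr_sumr mulrAC ler_wpM2r ?ler_wpM2l ?sum_half// ltW.
apply: ler_sum => l _; rewrite normrM normrX (gtr0_norm t0).
have rl : 0 < r ^+ (l + N.+1 + mdeg a) by rewrite exprn_gt0.
have := wM (l + N.+1)%N i a; rewrite -ler_pdivlMr// => wl.
apply: le_trans (ler_wpM2l (exprn_ge0 _ (ltW t0)) wl) _.
have -> : t ^+ (l + N.+1) * (M / r ^+ (l + N.+1 + mdeg a)) =
    B * t ^+ N.+1 * (t / r) ^+ l.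
  rewrite /B -addnA [t ^+ _]exprD [r ^+ (l + _)]exprD expr_div_n invfM.
  by move: (t ^+ l) (t ^+ _) (r ^- l) (r ^- _) => *; ring.
apply: ler_wpM2l; first by rewrite mulr_ge0// ltW.
rewrite lerXn2r ?nnegrE ?divr_ge0 ?invr_ge0 ?(ltW t0) ?(ltW r0)//.
rewrite ler_pdivrMr// mulrC; apply: ltW; exact: lt_le_trans zr.
Qed.

(** The components of the integrability condition of W t have expansions given
    by those of the jet, and vanish for all small t. *)
Lemma jet_integrable N : integrable_deformation W w ->
  forall i j k n, (n <= N)%N -> (wedge12 (jet N) (diff1 pder (jet N)) i j k)`_n = 0.
Proof.
move=> [aW /near0_pos iW] i j k.
have H := analytic_hasym N aW.
apply: (@hasym_eq0 N (fun t => wedge12 (W t) (diff1 (@holo_der K m) (W t)) i j k)).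
  by have [r r0 rW] := iW; exists r => // t t0 tr; apply: rW.
have Hd a b : hasym N (fun t => diff1 (@holo_der K m) (W t) a b) (diff1 pder (jet N) a b).
  rewrite [diff1 _ _ a b]mxE; under eq_fun do rewrite mxE.
  by apply: hasymB; apply: hasym_der.
by apply: hasymD; [apply: hasymB|]; apply: hasymM.
Qed.

End Families.

(** * The normal form, order by order *)

(** A sequence is built term by term: P n only looks at the terms up to n, and
    can be reached for n + 1 by changing the term n + 1 alone. *)
Lemma dependent_choice (T : Type) (s0 : nat -> T) (P : nat -> (nat -> T) -> Prop) :
  (forall n s s', (forall k, (k <= n)%N -> s k = s' k) -> P n s -> P n s') ->
  P 0%N s0 ->
  (forall n s, P n s -> exists x, P n.+1 (fun k => if k == n.+1 then x else s k)) ->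
  exists s, forall n, P n s.
Proof.
move=> Ploc P0 Pstep.
have next n (s : {s | P n s}) :
    {s' : {s | P n.+1 s} | forall k, (k <= n)%N -> sval s' k = sval s k}.
  case: s => s Ps; have [x Px] := cid (Pstep n s Ps).
  exists (exist _ _ Px) => k kn /=.
  by rewrite ltn_eqF.
pose fix f n : {s | P n s} :=
  if n is n'.+1 then sval (next n' (f n')) else exist _ _ P0.
have fS n k : (k <= n)%N -> sval (f n.+1) k = sval (f n) k.
  exact: (svalP (next n (f n))).
have fE n k : (k <= n)%N -> sval (f n) k = sval (f k) k.
  elim: n => [|n IH]; first by rewrite leqn0 => /eqP ->.
  rewrite leq_eqVlt => /predU1P[->//|kn]; rewrite fS ?IH//.
exists (fun n => sval (f n) n) => n.
apply: Ploc (svalP (f n)) => k kn; exact: fE.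
Qed.

Lemma wedge12_map (A B : comNzRingType) m (d : 'I_m -> A -> A) (d' : 'I_m -> B -> B)
    (phi : {rmorphism A -> B}) (v : 'rV[A]_m) a b c :
  (forall k x, phi (d k x) = d' k (phi x)) ->
  wedge12 (map_mx phi v) (diff1 d' (map_mx phi v)) a b c =
  phi (wedge12 v (diff1 d v) a b c).
Proof.
move=> phid; rewrite /wedge12 !mxE -!phid.
by rewrite !(rmorphB, rmorphD, rmorphM, rmorphN)/=.
Qed.

Section Mero.
Variables (K : numFieldType) (m : nat).

Lemma sub_rearrange (V : zmodType) (x p q r : V) :
  x - (p + q) - r = x - q - (p + r).
Proof. by rewrite !opprD !addrA; congr (_ - _); apply: addrAC. Qed.

Lemma mero_derAC i j (x : mero K m) :
  mero_der i (mero_der j x) = mero_der j (mero_der i x).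
Proof.
have [p [q [q0 xq]]] := mero_exists x.
have q0' : q%:F != 0 by rewrite tofrac_eq0.
have E k l : mero_der k (mero_der l x) * q%:F = (holo_der k (holo_der l p))%:F
    - x * (holo_der k (holo_der l q))%:F
    - (mero_der k x * (holo_der l q)%:F + mero_der l x * (holo_der k q)%:F).
  have := congr1 (mero_der k) (mero_der_eq l q0 xq).
  rewrite raddfB/= !mero_derM !mero_der_tofrac => /(canRL (addrK _)) ->.
  exact: sub_rearrange.
apply: (mulIf q0'); rewrite !E holo_derAC [holo_der i (holo_der j q)]holo_derAC.
congr (_ - _); exact: addrC.
Qed.

Lemma fps_prod1_eq (A : nzRingType) (a b : nat -> A) n :
  (forall k, (k <= n)%N -> a k = b k) -> fps_prod1 a n = fps_prod1 b n.
Proof.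
move=> ab; rewrite /fps_prod1; congr (polyseq _)`_ _.
by apply: eq_big_nat => k /andP[_ kn]; rewrite ab.
Qed.

Lemma fps_prod1_0 (A : nzRingType) (a : nat -> A) : fps_prod1 a 0 = 1.
Proof. by rewrite /fps_prod1 big_geq// coef1. Qed.

Lemma fps_prod1_stable (A : comNzRingType) (a : nat -> A) n N : (n < N)%N ->
  (\prod_(1 <= k < N) (1 + a k *: 'X^k))`_n = fps_prod1 a n.
Proof.
rewrite /fps_prod1; elim: N => [//|N IH] /=.
rewrite ltnS leq_eqVlt => /predU1P[->//|nN].
rewrite big_nat_recr/=; last by apply: leq_ltn_trans nN.
by rewrite mulrDr mulr1 coefD -scalerAr coefZ coefMXn nN mulr0 addr0 IH.
Qed.

Lemma fps_prod1S (A : comNzRingType) (a : nat -> A) n : (0 < n)%N ->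
  fps_prod1 a n = (\prod_(1 <= k < n) (1 + a k *: 'X^k))`_n + a n.
Proof.
move=> n0; rewrite /fps_prod1 big_nat_recr//= mulrDr mulr1 coefD -scalerAr.
rewrite coefZ coefMXn ltnn subnn (fps_prod1_stable a n0).
by rewrite fps_prod1_0 mulr1.
Qed.

(** For x = (a_k, h_k, alpha_k), the component number c of the coefficient of t^k
    in alpha(t) dF/F + dG/G + dH: the series beta can be taken constant. *)
Definition normal_coef (F G : holo K m) (x : mero K m * mero K m * K) (k : nat)
    (c : 'I_m) : mero K m :=
  (holoC m x.2)%:F * (mero_der c F%:F / F%:F)
  + (k == 0%N)%:R * (mero_der c G%:F / G%:F) + mero_der c x.1.2.

End Mero.

Section NormalForm.
Variables (K : numFieldType) (m : nat) (F G : holo K m) (lam : K).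
Variables (W : K -> 'rV[holo K m]_m) (Om : nat -> 'rV[holo K m]_m).
Hypothesis gp : general_position F G.
Hypothesis ld : dioph_pow lam.
Hypothesis deform : integrable_deformation W Om.
Hypothesis Om0 : Om 0%N = F *: dholo G - (holoC m lam * G) *: dholo F.
Local Notation T := (mero K m * mero K m * K)%type.
Local Notation E := ((F * G)%:F).

Definition start : T := (0, 0, - lam).

(** Poles outside F G = 0 are excluded all along, as required by the relative
    cohomology at the next order. *)
Definition normal_upto (n : nat) (s : nat -> T) :=
  s 0%N = start /\
  forall k, (k <= n)%N -> [/\ polar (F * G) (s k).1.1, polar (F * G) (s k).1.2 &
    forall c, (Om k 0 c)%:F = E * \sum_(l < k.+1)
      fps_prod1 (fun k => (s k).1.1) (k - l) * normal_coef F G (s l) l c].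

Let F0 : F != 0. Proof. by have [] := general_position_neq0 gp. Qed.
Let G0 : G != 0. Proof. by have [] := general_position_neq0 gp. Qed.
Let F0' : F%:F != 0. Proof. by rewrite tofrac_eq0. Qed.
Let G0' : G%:F != 0. Proof. by rewrite tofrac_eq0. Qed.
Let E0 : F * G != 0. Proof. exact: mulf_neq0. Qed.
Let E0' : E != 0. Proof. by rewrite tofrac_eq0. Qed.

Lemma normal_upto_local n s s' : (forall k, (k <= n)%N -> s k = s' k) ->
  normal_upto n s -> normal_upto n s'.
Proof.
move=> ss [s0 sn]; split=> [|k kn]; first by rewrite -ss.
have [sk1 sk2 skE] := sn k kn.
rewrite -!ss//; split=> // c; rewrite skE; congr (_ * _).
apply: eq_bigr => l _; have lk : (l <= k)%N by rewrite -ltnS.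
rewrite -ss ?(leq_trans lk)//; congr (_ * _); apply: fps_prod1_eq => i ik.
by rewrite ss// (leq_trans ik)// (leq_trans (leq_subr _ _)).
Qed.

Lemma start_identity (M : fieldType) (f g l df dg : M) : f != 0 -> g != 0 ->
  f * dg - l * g * df = f * g * (- l * (df / f) + dg / g).
Proof. by move=> f0 g0; field; rewrite f0 g0. Qed.

Lemma normal_upto0 : normal_upto 0 (fun=> start).
Proof.
split=> // k; rewrite leqn0 => /eqP ->; split; [exact: polar0..|move=> c].
rewrite big_ord1 fps_prod1_0 mul1r.
rewrite /normal_coef /= mulr1n mul1r raddf0 addr0.
rewrite Om0 !mxE tofracB !tofracM !mero_der_tofrac rmorphN rmorphN/=.
exact: (start_identity (holoC m lam)%:F _ _ F0' G0').
Qed.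

Lemma normal_coef_polar x k c : polar (F * G) x.1.2 ->
  polar (F * G) (normal_coef F G x k c).
Proof.
move=> xp; rewrite /normal_coef; apply: polarD; last exact: polar_der.
apply: polarD; rewrite ?mero_der_tofrac.
  apply: polarM; first exact: polar_tofrac.
  apply: polarM; first exact: polar_tofrac.
  exact: (polar_inv E0 (erefl _)).
rewrite -(rmorph_nat (@FracField.tofrac _)).
apply: polarM; first exact: polar_tofrac.
apply: polarM; first exact: polar_tofrac.
exact: (polar_inv E0 (mulrC F G)).
Qed.

Lemma normal_coef_closed x k i j :
  diff1 (@mero_der K m) (\row_c normal_coef F G x k c) i j = 0.
Proof.
pose dm := @mero_der K m.
pose logF : 'rV[mero K m]_m := \row_c (dm c F%:F / F%:F).
pose logG : 'rV[mero K m]_m := \row_c (dm c G%:F / G%:F).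
have -> : \row_c normal_coef F G x k c =
    (holoC m x.2)%:F *: logF + ((k == 0%N)%:R *: logG + diff0 dm x.1.2).
  by apply/rowP => c; rewrite !mxE /normal_coef addrA.
have closed := closed_scale_add (@mero_derB K m) (@mero_derM K m).
have logclosed f : f%:F != 0 -> forall i j, diff1 dm (\row_c (dm c f%:F / f%:F)) i j = 0.
  move=> f0 i' j'; set v := \row_c _.
  have vf c : v 0 c * f%:F = dm c f%:F by rewrite mxE divfK.
  exact: (closed_log (@mero_derM K m) (@mero_derAC K m) vf (mulfI f0)).
refine (closed (holoC m x.2)%:F logF ((k == 0%N)%:R *: logG + diff0 dm x.1.2)
  i j _ _ _) => [c|i' j'|i' j'].
- by rewrite mero_der_tofrac holo_derC rmorph0.
- exact: (logclosed F F0').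
apply: closed => [c|i2 j2|i2 j2].
- rewrite -(rmorph_nat (@FracField.tofrac _)) mero_der_tofrac.
  by rewrite -(rmorph_nat (@holoC K m)) holo_derC rmorph0.
- exact: (logclosed G G0').
- exact: (closed_exact (@mero_derAC K m)).
Qed.


Lemma taylor_integrable n a b c :
  (wedge12 (\row_i \poly_(k < n.+1) (Om k 0 i)%:F)
    (diff1 (polyder (@mero_der K m)) (\row_i \poly_(k < n.+1) (Om k 0 i)%:F))
    a b c)`_n = 0.
Proof.
pose phi : {rmorphism {poly holo K m} -> {poly mero K m}} :=
  map_poly (@FracField.tofrac (holo K m)).
have -> : \row_i \poly_(k < n.+1) (Om k 0 i)%:F = map_mx phi (jet Om n).
  apply/rowP => i; rewrite !mxE; apply/polyP => k.
  by rewrite coef_map/= !coef_poly; case: ifP; rewrite ?rmorph0.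
rewrite (wedge12_map (d := polyder (@holo_der K m))) => [|k p].
  by rewrite coef_map/= (jet_integrable deform)// rmorph0.
apply/polyP => i; rewrite coef_map/= !coef_polyder ?coef_map/=.
- by rewrite mero_der_tofrac.
- by move=> *; rewrite raddfB.
- by move=> *; rewrite raddfB.
Qed.

Lemma poly_polar (s : nat -> T) n : (forall k, (k <= n)%N -> polar (F * G) (s k).1.1) ->
  forall i, polar (F * G) (\prod_(1 <= k < n.+1) (1 + (s k).1.1 *: 'X^k))`_i.
Proof.
move=> sn; rewrite big_nat.
elim/big_ind: _ => [i|p q pp qp i|k /andP[_ kn] i].
- rewrite coef1 -(rmorph_nat (@FracField.tofrac _)); exact: polar_tofrac.
- by rewrite coefM; apply: polar_sum => l; apply: polarM.
rewrite coefD coef1 coefZ coefXn; apply: polarD.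
  rewrite -(rmorph_nat (@FracField.tofrac _)); exact: polar_tofrac.
apply: polarM; first by apply: sn; rewrite -ltnS.
rewrite -(rmorph_nat (@FracField.tofrac _)); exact: polar_tofrac.
Qed.

(** Let xi be the difference, divided by F G, between the coefficient of t^(n+1)
    in the deformation and the one obtained from the terms chosen so far. It is
    relatively closed, so xi = a omega0 + kappa dF/F + d h, where a changes the
    unit, kappa changes alpha and h changes H, each at order n + 1 only. *)
Lemma normal_upto_step n s : normal_upto n s ->
  exists x, normal_upto n.+1 (fun k => if k == n.+1 then x else s k).
Proof.
move=> [s0 sn]; pose N := n.+1.
pose theta l c := normal_coef F G (s l) l c.
pose U := \prod_(1 <= k < N) (1 + (s k).1.1 *: 'X^k).
pose eta : 'rV[{poly mero K m}]_m := \row_c \poly_(l < N) theta l c.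
have UE k : (k < N)%N -> U`_k = fps_prod1 (fun k => (s k).1.1) k.
  exact: fps_prod1_stable.
have UetaN c : (U * eta 0 c)`_N = \sum_(l < N) U`_(N - l) * theta l c.
  rewrite coefMr big_ord_recr/= mxE coef_poly ltnn mulr0 addr0.
  by apply: eq_bigr => l _; rewrite coef_poly ltn_ord.
have Uetak k c : (k < N)%N -> (U * eta 0 c)`_k =
    \sum_(l < k.+1) fps_prod1 (fun k => (s k).1.1) (k - l) * theta l c.
  move=> kN; rewrite coefMr; apply: eq_bigr => l _.
  rewrite mxE coef_poly (leq_trans (ltn_ord l))// UE//.
  by apply: leq_ltn_trans kN; apply: leq_subr.
pose xi : 'rV[mero K m]_m := \row_c ((Om N 0 c)%:F / E - (U * eta 0 c)`_N).
have eta0 : \row_i (eta 0 i)`_0 =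
    log_form (@mero_der K m) F%:F G%:F (holoC m lam)%:F.
  apply/rowP => c; rewrite !mxE coef_poly /= /theta s0 /normal_coef /=.
  by rewrite raddf0 addr0 mulr1n mul1r rmorphN rmorphN/= mulNr addrC.
have eta_closed i j : diff1 (polyder (@mero_der K m)) eta i j = 0.
  apply/polyP => k; rewrite coef0 !mxE coefB !coef_polyder ?coef_poly.
  - case: ifP => _; last by rewrite !raddf0 addr0.
    by have := normal_coef_closed (s k) k i j; rewrite !mxE.
  - by move=> *; rewrite raddfB.
  - by move=> *; rewrite raddfB.
have xi_closed := obstruction_closed (@mero_derB K m) (@mero_derM K m)
  (Om := fun k => to_mero (Om k)) (E := E) (U := U) (eta := eta) (n := N) (xi := xi).
have {}xi_closed : forall a b c, wedge12 (\row_i (eta 0 i)`_0)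
    (diff1 (@mero_der K m) xi) a b c = 0.
  apply: xi_closed => //.
  - by rewrite UE// fps_prod1_0.
  - move=> k c kN; rewrite mxE Uetak//; have [_ _ ->//] := sn k kN.
  - by move=> c; rewrite !mxE addrC subrK mulrC divfK.
  - move=> a b c; under eq_mx do under eq_poly do rewrite mxE.
    exact: taylor_integrable.
rewrite eta0 in xi_closed.
have s_polar k : (k <= n)%N -> polar (F * G) (s k).1.1.
  by move=> kn; have [] := sn k kn.
have xi_polar c : polar (F * G) (xi 0 c).
  rewrite mxE; apply: polarB.
    apply: polarM; first exact: polar_tofrac.
    exact: (polar_inv E0 (esym (mulr1 _))).
  rewrite UetaN; apply: polar_sum => l; apply: polarM.
    exact: poly_polar.
  apply: normal_coef_polar.
  by have [] := sn l (ltn_ord l : (l <= n)%N).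
have [a [h [kappa [aP hP xiE]]]] := relative_cohomology gp ld xi_polar xi_closed.
exists (a, h, kappa); set s' := fun k => _.
have s's k : (k <= n)%N -> s k = s' k by move=> kn; rewrite /s' ltn_eqF.
have s'N : s' N = (a, h, kappa) by rewrite /s' eqxx.
split=> [|k]; first by rewrite -s's.
rewrite leq_eqVlt => /predU1P[->|]; last first.
  rewrite ltnS => kn.
  by have [_ /(_ k kn)] := normal_upto_local s's (conj s0 sn).
rewrite -/N s'N; split=> // c.
have fpsE (l : 'I_N) : fps_prod1 (fun k => (s' k).1.1) (N - l) =
    U`_(N - l) + (l == 0%N :> nat)%:R * a.
  have [->|l0] := eqVneq (l : nat) 0%N.
    rewrite subn0 fps_prod1S// s'N mul1r; congr ((polyseq _)`_ _ + _).
    by apply: eq_big_nat => k' /andP[_ kN]; rewrite s's.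
  rewrite mul0r addr0 UE; last first.
    by rewrite /N ltn_subrL lt0n l0.
  by apply: fps_prod1_eq => i iN; rewrite -s's//; lia.
rewrite big_ord_recr/= subnn fps_prod1_0 mul1r s'N.
have -> : \sum_(l < N) fps_prod1 (fun k => (s' k).1.1) (N - l) *
    normal_coef F G (s' l) l c = (U * eta 0 c)`_N + a * theta 0%N c.
  rewrite UetaN (eq_bigr (fun l : 'I_N => U`_(N - l) * theta l c
      + (l == 0%N :> nat)%:R * (a * theta l c))); last first.
    move=> l _; rewrite fpsE mulrDl -mulrA -s's//.
    by rewrite -ltnS.
  rewrite big_split/=; congr (_ + _).
  by rewrite big_ord_recl/= mul1r big1 ?addr0// => l _; rewrite mul0r.
have -> : theta 0%N c = log_form (@mero_der K m) F%:F G%:F (holoC m lam)%:F 0 c.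
  by rewrite -eta0 !mxE coef_poly.
have := xiE c; rewrite [xi 0 c]mxE => /(canRL (subrK _)) e.
have {e} := congr1 (fun y => E * y) e; rewrite mulrC divfK// => ->.
congr (_ * _); rewrite /normal_coef /= mul0r addr0.
by rewrite [LHS]addrC !addrA.
Qed.

Lemma normal_form_exists : exists s, forall n, normal_upto n s.
Proof.
exact: (dependent_choice normal_upto_local normal_upto0 normal_upto_step).
Qed.

End NormalForm.

(** * The theorem *)

(** The exponent delta is replaced by a larger natural number; |x| + |y| >= 1. *)
Lemma diophantine_pow (R : realType) (lam : Cplx R) :
  diophantine lam -> dioph_pow lam.
Proof.
move=> [c [delta [c0 d0 H]]].
exists c%:C%C, (Num.bound delta); split; first by rewrite ltcR.
move=> x y xy; have yx : (y, x) != (0, 0).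
  by apply: contraNneq xy => -[-> ->].
have N1 : 1 <= (`|x| + `|y|)%:~R :> R.
  rewrite -[1]/(1%:~R) ler_int.
  rewrite -gtz0_ge1; move: xy; rewrite xpair_eqE negb_and => /orP[x0|y0].
    by rewrite ltr_pwDl// normr_gt0.
  by rewrite ltr_wpDl// normr_gt0.
have := H _ _ yx; rewrite [`|y| + `|x|]addrC [lam * _ + _]addrC.
set N := (_ + _)%:~R in N1 * => HN.
have N0 : 0 < N := lt_le_trans ltr01 N1.
have -> : (`|x| + `|y|)%:~R ^+ Num.bound delta = (N ^+ Num.bound delta)%:C%C :> Cplx R.
  by rewrite rmorphXn/= /N rmorph_int.
apply: (@le_trans _ _ ((c / N `^ delta)%:C%C * (N ^+ Num.bound delta)%:C%C)).
  rewrite -rmorphM/= lecR mulrAC ler_pdivlMr ?powR_gt0// ler_pM2l//.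
  rewrite -powR_mulrn ?(ltW N0)// ler_powR// ltW// archi_boundP//.
by rewrite ler_wpM2r// lecR exprn_ge0// ltW.
Qed.

Lemma clear_denominators (M : fieldType) (f g u x y df dg dh : M) :
  f != 0 -> g != 0 ->
  f * g * (u * (x * (df / f) + y * (dg / g) + dh)) =
  u * (x * g * df + y * f * dg + f * g * dh).
Proof. by move=> f0 g0; field; rewrite f0 g0. Qed.

Theorem theoremH (R : realType) (m : nat) (hm : (3 <= m)%N)
  (F G : holo (Cplx R) m)
  (redF : reduced_elt F) (redG : reduced_elt G)
  (irrF : irreducible_elt F) (irrG : irreducible_elt G)
  (gpFG : general_position F G)
  (lam : Cplx R) (lam_irrational : forall q : rat, lam <> ratr q)
  (lam_dioph : diophantine lam)
  (W : Cplx R -> 'rV[holo (Cplx R) m]_m)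
  (Omega : nat -> 'rV[holo (Cplx R) m]_m)
  (deform : integrable_deformation W Omega)
  (Omega0 : Omega 0%N = F *: dholo G - (holoC m lam * G) *: dholo F) :
  exists (a h : nat -> mero (Cplx R) m) (alpha beta : nat -> Cplx R),
    [/\ h 0%N = 0, alpha 0%N = - lam, beta 0%N = 1 &
      forall n : nat,
        to_mero (Omega n) =
        fps_scale (fps_prod1 a)
          (fun k =>
             to_mero ((holoC m (alpha k) * G) *: dholo F
                      + (holoC m (beta k) * F) *: dholo G)
             + (F * G)%:F *: dmero (h k)) n].
Proof.
have [s sP] := normal_form_exists gpFG (diophantine_pow lam_dioph) deform Omega0.
have [s0 _] := sP 0%N.
exists (fun k => (s k).1.1), (fun k => (s k).1.2), (fun k => (s k).2).
exists (fun k => (k == 0%N)%:R); rewrite s0; split=> // n.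
have [_ /(_ n (leqnn n))[_ _ sE]] := sP n.
apply/rowP => c; rewrite mxE sE /fps_scale summxE mulr_sumr.
apply: eq_bigr => k _; rewrite !mxE.
rewrite tofracD !tofracM /normal_coef !mero_der_tofrac !(rmorph_nat _ _).
have [F0 G0] := general_position_neq0 gpFG.
by apply: clear_denominators; rewrite tofrac_eq0.
Qed.
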